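(* Let $n\ge1$, let $\mathbf{k}=(k_1,\ldots,k_s)$ be positive integers with $|\mathbf{k}|=k_1+\dots+k_s$, and let $q,w,z_1,\dots,z_s$ be indeterminates. Then \begin{multline*} \frac{(qw^2;q^2)_n}{(w^2;q)_n}\, \prod_{l=1}^s \frac{(q^{-k_l}w/z_l;q)_n}{ (w/z_l;q)_n}\, {}_{2s+2}\phi_{2s+1} \left[\begin{matrix} w^2/q,q^{-n},\{w/z_l,q^{k_l}wz_l\}_{l=1}^s\\ q^nw^2,\{wz_l,q^{-k_l}w/z_l\}_{l=1}^s \end{matrix};q,-q^{n-|\mathbf{k}|+1} \right]\\ =q^{-\binom{|\mathbf{k}|}{2}}\,(-q;q)_{n-|\mathbf{k}|}\, \prod_{1\le a< b\le s}\frac{(q^{k_b+1}z_az_b;q)_{k_a}}{(qz_az_b;q)_{k_a}}\,\prod_{a=1}^s \frac{(qz_a^2;q^2)_{k_a}}{(qz_a^2;q)_{k_a}}\\\times \sum_{\mathbf{m}\le \mathbf{k}} (-1)^{|\mathbf{m}|}c_{\mathbf{m}}\,q^{(|\mathbf{k}|-n)|\mathbf{m}|} \, \prod_{l=1}^s \frac{(q^nwz_l;q)_{m_l}}{(wz_l;q)_{m_l}} \,\frac{(qz_l/w;q)_{m_l}}{(q^{1-n}z_l/w;q)_{m_l}}, \end{multline*} where the sum runs over $\mathbf{m}=(m_1,\dots,m_s)\in\mathbb{N}^s$ with $0\le m_l\le k_l$ for all $l$, $|\mathbf{m}|=m_1+\dots+m_s$, and \[ c_{\mathbf{m}}= \prod_{1\le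 a<b\le s}\frac{q^{m_a}z_a-q^{m_b}z_b}{z_a-z_b}\, \prod_{1\le a\le b\le s}\frac{1-q^{m_a+m_b}z_az_b}{1-z_az_b}\, \prod_{a,b=1}^s\frac{(q^{-k_b}z_a/z_b;q)_{m_a}}{(qz_a/z_b;q)_{m_a}}\, \frac{(z_az_b;q)_{m_a}}{(q^{1+k_b}z_az_b;q)_{m_a}}. \]
   Context: $(a;q)_m=\prod_{l=0}^{m-1}(1-aq^l)$ for $m\ge0$. The symbol $(-q;q)_m$ equals $\prod_{k=1}^m(q^k+1)$ for $m\ge0$ and $\prod_{k=0}^{-m-1}(q^{-k}+1)^{-1}$ for $m<0$. ${}_{p+1}\phi_p\left[\begin{matrix}a_1,\dots,a_{p+1}\\ b_1,\dots,b_p\end{matrix};q,y\right]=\sum_{i\ge0}\frac{(a_1;q)_i\cdots(a_{p+1};q)_i}{(b_1;q)_i\cdots(b_p;q)_i}\frac{y^i}{(q;q)_i}$; $\{w/z_l,q^{k_l}wz_l\}_{l=1}^s$ lists the $2s$ parameters $w/z_1,q^{k_1}wz_1,\dots,w/z_s,q^{k_s}wz_s$ (similarly in the denominator). The series terminates because of the parameter $q^{-n}$. *)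

(* Defs.v *)
From mathcomp Require Export all_boot all_order all_algebra.
From mathcomp Require Export mpoly.
From mathcomp Require Export classical_sets fsbigop.

Set Implicit Arguments.
Unset Strict Implicit.
Unset Printing Implicit Defensive.

Import GRing.Theory.

Local Open Scope ring_scope.

(* K(X_0, ..., X_(N-1)) *)
Definition ratfun (K : fieldType) (N : nat) : fieldType :=
  {fraction {mpoly K[N]}}.

Definition indet (K : fieldType) (N : nat) (i : 'I_N) : ratfun K N :=
  tofrac ('X_i : {mpoly K[N]}).

Section QSeries.

Variable F : fieldType.
Implicit Types a q y : F.

Definition qpoch a q (m : nat) : F := \prod_(0 <= l < m) (1 - a * q ^+ l).

(* (-q; q)_m for m : int; note that Negz m' is the integer - (m' + 1). *)
Definition qpochN q (m : int) : F :=
  match m with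
  | Posz m' => \prod_(1 <= k < m'.+1) (q ^+ k + 1)
  | Negz m' => \prod_(0 <= k < m'.+1) (q ^- k + 1)^-1
  end.

(* The basic hypergeometric series with upper parameters A and lower
   parameters B, to be used with size A = size B + 1.  The sum over nat is a
   finitely supported one, so this is meaningful only for terminating series
   (the big operator returns 0 when the support is infinite). *)
Definition qhyp (A B : seq F) q y : F :=
  \sum_(i \in [set: nat]%classic)
     (\prod_(a <- A) qpoch a q i) / (\prod_(b <- B) qpoch b q i)
     * (y ^+ i / qpoch q q i).

Variable s : nat.
Implicit Types (k m : 'I_s -> nat) (z u v : 'I_s -> F).

Definition weight k : nat := (\sum_(l < s) k l)%N.

Definition interleave u v : seq F :=
  flatten [seq [:: u l; v l] | l <- enum 'I_s].

Definition coef_c q z k m : F :=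
  (\prod_(a < s) \prod_(b < s | (a < b)%N)
      ((q ^+ m a * z a - q ^+ m b * z b) / (z a - z b)))
  * (\prod_(a < s) \prod_(b < s | (a <= b)%N)
      ((1 - q ^+ (m a + m b) * z a * z b) / (1 - z a * z b)))
  * (\prod_(a < s) \prod_(b < s)
      (qpoch (q ^- k b * z a / z b) q (m a) / qpoch (q * z a / z b) q (m a)
       * (qpoch (z a * z b) q (m a)
          / qpoch (q ^+ (1 + k b) * z a * z b) q (m a)))).

End QSeries.

(* Main.v *)
Require Import Defs.
From mathcomp Require Import fintype finset ring zify.

Set Implicit Arguments.
Unset Strict Implicit.
Unset Printing Implicit Defensive.

Import GRing.Theory.

Local Open Scope ring_scope.

(* The heart of the matter is the case where all k_l = 1.  Write p_a for either
   z_a or its reflection 1 / (q z_a), and g(x) = (1 - q^2 x) / (1 - q x).  In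
   that case the right-hand side becomes a sum over the choices of reflected
   indices of  prod_(a < b) g(p_a p_b)
               * prod_a (1 - w p_a) (1 - q^n w / (q p_a)),
   and the left-hand side a well-poised sum of
   prod_a (1 - q^i w z_a) (1 - q^i w / (q z_a)).
   As functions of one variable t = z_a, both sides are invariant under the
   reflection t -> 1 / (q t); after clearing denominators their difference is
   a polynomial of degree at most 2 N for N variables.  It vanishes at the 2 N - 2
   poles of the right-hand side, where the residues cancel in pairs, at w / q and
   1 / w, where it reduces to the identity with (N, n, w) replaced by
   (N - 1, n - 1, q w), and at 0, where it reduces to (N - 1, n, w).  This
   is one root too many, so the identity follows by induction on N from the
   terminating Bailey-Daum sum N = 0.

   The general case is the specialization of the variables to the geometric
   progressions z_l, q z_l, ..., q^(k_l - 1) z_l.  Since g(q^-2) = 0, a choice of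
   reflections contributes only when the reflected points form an initial
   segment of each block, of length m_l say, and the products of the factors g
   over pairs of points telescope to the coefficients c_m. *)

(** * Bailey-Daum sum *)

Section QPochhammer.
Variable F : fieldType.
Implicit Types a q : F.

Lemma qpoch0 a q : qpoch a q 0 = 1.
Proof. by rewrite /qpoch big_geq. Qed.

Lemma qpochS a q m : qpoch a q m.+1 = qpoch a q m * (1 - a * q ^+ m).
Proof. by rewrite /qpoch big_nat_recr. Qed.

Lemma qpochSl a q m : qpoch a q m.+1 = (1 - a) * qpoch (a * q) q m.
Proof.
rewrite /qpoch big_nat_recl //= expr0 mulr1; congr (_ * _).
by apply: eq_bigr => i _; rewrite exprS mulrA.
Qed.

Lemma qpoch_neq0 a q m :
  (forall l, (l < m)%N -> a * q ^+ l != 1) -> qpoch a q m != 0.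
Proof.
move=> h; rewrite /qpoch big_mkord; apply/prodf_neq0 => i _.
by rewrite subr_eq0 eq_sym; apply: h.
Qed.

(** The two branches of the definition obey a single recurrence. They meet at m = -1, where the
    factor q^0 + 1 = 2 has to cancel; the hypothesis at i = 0 thus excludes characteristic 2. *)
Lemma qpochN_succ q (m : int) : q != 0 -> (forall i : nat, q ^+ i + 1 != 0) ->
  qpochN q (m + 1) = qpochN q m * (q ^ (m + 1) + 1).
Proof.
move=> q0 hq; case: m => [m|[|m]].
- by rewrite -PoszD addn1 /qpochN big_nat_recr.
- rewrite /= big_nat1 big_geq // expr0z expr0 invr1 mulVf //.
  by have := hq 0%N; rewrite expr0.
have -> : Negz m.+1 + 1 = Negz m by lia.
rewrite /= [in RHS]big_nat_recr //= -mulrA -[q ^ Negz m]/(q ^- m.+1) mulVf ?mulr1 //.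
have h : q ^+ m.+1 != 0 by rewrite expf_neq0.
rewrite -(mulfK h (_ + 1)) mulf_neq0 ?invr_eq0 // mulrDl mulVf // mul1r addrC.
exact: hq.
Qed.

End QPochhammer.

Section BaileyDaum.
Variables (F : fieldType) (q : F).
Hypothesis q_neq0 : q != 0.
Hypothesis q_expn : forall i, (0 < i)%N -> q ^+ i != 1.
Implicit Types (w y : F) (f : nat -> F).

Lemma w2_shift w : (forall i : int, w ^+ 2 != q ^ i) ->
  forall i : int, (q * w) ^+ 2 != q ^ i.
Proof.
move=> hw i; apply: contra (hw (i - 2%:Z)) => /eqP e.
by rewrite expfzDr // -e -exprnN exprMn mulrAC divff ?mul1r // expf_neq0.
Qed.

(** The part of the i-th term that is free of the z_l. It is well-poised with respect to w^2 / q,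
    since q (w^2 / q) = q^(-n) q^n w^2. *)
Definition wp_coef n w i : F :=
  qpoch (w ^+ 2 / q) q i * qpoch (q ^- n) q i
  / (qpoch (q ^+ n * w ^+ 2) q i * qpoch q q i).

Definition wp_pref n w : F := qpoch (q * w ^+ 2) (q ^+ 2) n / qpoch (w ^+ 2) q n.

(** Keeping [f] arbitrary lets the same shift relation serve the Bailey-Daum sum and the sums with
    variables z_a. *)
Definition wp_sum n w y f : F :=
  wp_pref n w * \sum_(i < n.+1) wp_coef n w i * y ^+ i * f i.

Lemma qpochq_neq0 i : qpoch q q i != 0.
Proof. by apply: qpoch_neq0 => l _; rewrite -exprS q_expn. Qed.

Lemma qpochw_neq0 w n i : (forall i : int, w ^+ 2 != q ^ i) ->
  qpoch (q ^+ n * w ^+ 2) q i != 0.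
Proof.
move=> hw; apply: qpoch_neq0 => l _; apply/eqP => e.
have /eqP := hw (- (n + l)%N%:Z); apply.
have h : q ^+ (n + l) != 0 by rewrite expf_neq0.
by apply: (mulfI h); rewrite -exprnN divff // -e exprD mulrAC.
Qed.

Lemma qexp_w_neq0 w n : (forall i : int, w ^+ 2 != q ^ i) ->
  1 - q ^+ n * w ^+ 2 != 0.
Proof.
by move=> hw; have := qpochw_neq0 n 1 hw; rewrite qpochS qpoch0 mul1r expr0 mulr1.
Qed.

(** The first extra factor cuts (q; q)_(i+1) down to (q; q)_i. The second one extends (w^2 / q;
    q)_(i+1), from which the two leading factors split off to leave the base (q w)^2 / q. *)
Lemma wp_coef_shift n w i : (forall i : int, w ^+ 2 != q ^ i) ->
  wp_coef n.+1 w i.+1 * ((1 - q ^+ i.+1) * (1 - q ^+ i.+1 * w ^+ 2 / q)) =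
  (1 - w ^+ 2 / q) * (1 - w ^+ 2) * (1 - q ^- n.+1)
  / (1 - q ^+ n.+1 * w ^+ 2) * wp_coef n (q * w) i.
Proof.
move=> hw; rewrite /wp_coef.
have e1 : qpoch (w ^+ 2 / q) q i.+1 * (1 - q ^+ i.+1 * w ^+ 2 / q) =
   (1 - w ^+ 2 / q) * (1 - w ^+ 2) * qpoch ((q * w) ^+ 2 / q) q i.
  have -> : q ^+ i.+1 * w ^+ 2 / q = w ^+ 2 / q * q ^+ i.+1 by ring.
  rewrite -qpochS qpochSl divfK // qpochSl mulrA.
  by congr (_ * qpoch _ _ _); field.
have e2 : qpoch (q ^- n.+1) q i.+1 = (1 - q ^- n.+1) * qpoch (q ^- n) q i.
  by rewrite qpochSl exprS invfM mulrAC mulVf // mul1r.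
have e3 : qpoch (q ^+ n.+1 * w ^+ 2) q i.+1 =
    (1 - q ^+ n.+1 * w ^+ 2) * qpoch (q ^+ n * (q * w) ^+ 2) q i.
  by rewrite qpochSl; congr (_ * qpoch _ _ _); rewrite exprS; ring.
have n1 := qexp_w_neq0 n.+1 hw.
have n2 := qpochw_neq0 n.+1 i.+1 hw.
have n3 : qpoch (q ^+ n * (q * w) ^+ 2) q i != 0.
  by move: n2; rewrite e3 mulf_eq0 negb_or => /andP[].
have n4 := qpochq_neq0 i.
have n5 : 1 - q ^+ i.+1 != 0 by rewrite subr_eq0 eq_sym q_expn.
rewrite [qpoch q q _]qpochS -exprS e3 e2.
transitivity (qpoch (w ^+ 2 / q) q i.+1 * (1 - q ^+ i.+1 * w ^+ 2 / q) *
  ((1 - q ^- n.+1) * qpoch (q ^- n) q i) /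
  ((1 - q ^+ n.+1 * w ^+ 2) * qpoch (q ^+ n * (q * w) ^+ 2) q i * qpoch q q i)).
  move: (qpoch q q i) (qpoch (q ^+ n * _) q i) (qpoch (q ^- n) q i) n3 n4.
  move: (qpoch (w ^+ 2 / q) q i.+1) n1 n5; rewrite -exprVn.
  move: (q ^+ i.+1) (q ^+ n.+1) (q^-1 ^+ n.+1)=> a b c d d1 d2 e f g d3 d4.
  by field; rewrite ?d1 ?d2 ?d3 ?d4 ?q_neq0.
rewrite e1 -exprVn; move: n3 n4 n1.
move: (qpoch q q i) (qpoch (q ^+ n * (q * w) ^+ 2) q i) (q ^+ n.+1).
move: (qpoch (q^-1 ^+ n) q i) (qpoch ((q * w) ^+ 2 / q) q i) (q^-1 ^+ n.+1).
by move=> a b c d e f d1 d2 d3; field; rewrite ?d1 ?d2 ?d3 ?q_neq0.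
Qed.

Lemma wp_pref_shift n w : (forall i : int, w ^+ 2 != q ^ i) ->
  wp_pref n.+1 w =
    wp_pref n (q * w) * (1 - q ^+ n.+1 * w ^+ 2) / (1 - w ^+ 2).
Proof.
move=> hw; rewrite /wp_pref.
have n1 := qexp_w_neq0 n.+1 hw.
have n0 : 1 - q * w ^+ 2 != 0 by have := qexp_w_neq0 1 hw.
have n2 : 1 - w ^+ 2 != 0 by have := qexp_w_neq0 0 hw; rewrite mul1r.
have e1 : qpoch (w ^+ 2) q n.+1 * (1 - q ^+ n.+1 * w ^+ 2) =
    (1 - w ^+ 2) * (1 - q * w ^+ 2) * qpoch ((q * w) ^+ 2) q n.
  rewrite [q ^+ _ * _]mulrC -qpochS qpochSl qpochSl [w ^+ 2 * q]mulrC mulrA.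
  by congr (_ * qpoch _ _ _); ring.
have n3 : qpoch (w ^+ 2) q n.+1 != 0.
  by have := qpochw_neq0 0 n.+1 hw; rewrite mul1r.
have n4 : qpoch ((q * w) ^+ 2) q n != 0.
  by have : qpoch (w ^+ 2) q n.+1 * (1 - q ^+ n.+1 * w ^+ 2) != 0;
    [rewrite mulf_neq0 | rewrite e1 mulf_eq0 negb_or => /andP[]].
have -> : qpoch (q * w ^+ 2) (q ^+ 2) n.+1 =
   (1 - q * w ^+ 2) * qpoch (q * (q * w) ^+ 2) (q ^+ 2) n.
  by rewrite qpochSl; congr (_ * qpoch _ _ _); ring.
apply: (mulIf (mulf_neq0 n3 n1)).
rewrite {2}e1; move: n3 n4 n1.
move: (qpoch (w ^+ 2) q n.+1) (qpoch ((q * w) ^+ 2) q n) (q ^+ n.+1).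
move: (qpoch (q * (q * w) ^+ 2) (q ^+ 2) n) => a b c d d1 d2 d3.
by field; rewrite ?d1 ?d2 ?n2 ?q_neq0.
Qed.

(** Each extra factor trades a shifted factorial of order n + 1 for the one of order n, with w
    fixed. *)
Lemma wp_coef_down n w i : (forall i : int, w ^+ 2 != q ^ i) ->
  wp_coef n.+1 w i * ((1 - q ^+ (i + n) * w ^+ 2) * (1 - q ^+ i / q ^+ n.+1)) =
  (1 - q ^+ n * w ^+ 2) * (1 - q ^- n.+1) * wp_coef n w i.
Proof.
move=> hw; rewrite /wp_coef.
have e1 : qpoch (q ^+ n * w ^+ 2) q i * (1 - q ^+ (i + n) * w ^+ 2) =
    (1 - q ^+ n * w ^+ 2) * qpoch (q ^+ n.+1 * w ^+ 2) q i.
  have -> : q ^+ (i + n) * w ^+ 2 = q ^+ n * w ^+ 2 * q ^+ i by rewrite exprD; ring.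
  by rewrite -qpochS qpochSl; congr (_ * qpoch _ _ _); rewrite [q ^+ n.+1]exprS; ring.
have e2 : qpoch (q ^- n.+1) q i * (1 - q ^+ i / q ^+ n.+1) =
    (1 - q ^- n.+1) * qpoch (q ^- n) q i.
  rewrite [_ / _]mulrC -qpochS qpochSl; congr (_ * qpoch _ _ _).
  by rewrite exprS invfM mulrAC mulVf // mul1r.
have n1 := qpochw_neq0 n i hw.
have n2 := qpochw_neq0 n.+1 i hw.
have n3 := qpochq_neq0 i.
have n4 := qexp_w_neq0 n hw.
have -> : 1 - q ^+ (i + n) * w ^+ 2 = (1 - q ^+ n * w ^+ 2) *
   qpoch (q ^+ n.+1 * w ^+ 2) q i / qpoch (q ^+ n * w ^+ 2) q i.
  by rewrite -e1 mulrAC divff // mul1r.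
transitivity (qpoch (w ^+ 2 / q) q i * (qpoch (q ^- n.+1) q i * (1 - q ^+ i / q ^+ n.+1))
  * (1 - q ^+ n * w ^+ 2) / (qpoch (q ^+ n * w ^+ 2) q i * qpoch q q i)).
  move: n1 n2 n3.
  move: (qpoch q q i) (qpoch (q ^+ n.+1 * w ^+ 2) q i) (qpoch (w ^+ 2 / q) q i).
  move: (qpoch (q ^+ n * w ^+ 2) q i) (qpoch (q ^- n.+1) q i) (_ / q ^+ n.+1).
  by move=> a b c d e f d1 d2 d3; field; rewrite ?d1 ?d2 ?d3.
by rewrite e2; ring.
Qed.

Lemma wp_pref_down n w : (forall i : int, w ^+ 2 != q ^ i) ->
  wp_pref n.+1 w * (1 - q ^+ n * w ^+ 2) = (1 - q ^+ (2 * n).+1 * w ^+ 2) * wp_pref n w.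
Proof.
move=> hw; rewrite /wp_pref 2!qpochS.
have -> : q * w ^+ 2 * (q ^+ 2) ^+ n = q ^+ (2 * n).+1 * w ^+ 2.
  by rewrite -exprM [q ^+ _.+1]exprS; ring.
have n1 := qexp_w_neq0 n hw; rewrite [w ^+ 2 * _]mulrC.
have n2 : qpoch (w ^+ 2) q n != 0 by have := qpochw_neq0 0 n hw; rewrite mul1r.
by rewrite invfM; move: n1 n2; move: (_^-1) => *; field; rewrite ?n1.
Qed.

(** The factor 1 - q^i removes the term i = 0, so the sum restarts at i = 1 with n lowered and w
    replaced by q w. *)
Lemma wp_sum_shift n w y f : (forall i : int, w ^+ 2 != q ^ i) ->
  wp_sum n.+1 w y (fun i => (1 - q ^+ i) * (1 - q ^+ i * w ^+ 2 / q) * f i) =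
  (1 - w ^+ 2 / q) * (1 - q ^- n.+1) * y * wp_sum n (q * w) y (fun i => f i.+1).
Proof.
move=> hw; rewrite /wp_sum big_ord_recl expr0 subrr mul0r mul0r mulr0 add0r.
rewrite wp_pref_shift // !mulr_sumr; apply: eq_bigr => i _; rewrite lift0.
have n1 := qexp_w_neq0 n.+1 hw.
have n2 : 1 - w ^+ 2 != 0 by have := qexp_w_neq0 0 hw; rewrite mul1r.
have := wp_coef_shift n i hw; rewrite [y ^+ i.+1]exprS => e.
transitivity (wp_pref n (q * w) * (1 - q ^+ n.+1 * w ^+ 2) / (1 - w ^+ 2)
  * (wp_coef n.+1 w i.+1 * ((1 - q ^+ i.+1) * (1 - q ^+ i.+1 * w ^+ 2 / q)))
  * y * y ^+ i * f i.+1); first by ring.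
rewrite {}e; move: n1 n2; rewrite -exprVn.
move: (wp_pref _ _) (wp_coef _ _ _) (q ^+ n.+1) (q^-1 ^+ _) (y ^+ i) (f _).
by move=> a b c d e g n1 n2; field; rewrite ?n1 ?n2 ?q_neq0.
Qed.

(** Here the removed term is the last one, i = n + 1. *)
Lemma wp_sum_down n w y f : (forall i : int, w ^+ 2 != q ^ i) ->
  wp_sum n.+1 w y
    (fun i => (1 - q ^+ (i + n) * w ^+ 2) * (1 - q ^+ i / q ^+ n.+1) * f i) =
  (1 - q ^- n.+1) * (1 - q ^+ (2 * n).+1 * w ^+ 2) * wp_sum n w y f.
Proof.
move=> hw; rewrite /wp_sum big_ord_recr /= divff ?expf_neq0 // subrr mulr0 mul0r.
rewrite mulr0 addr0 !mulr_sumr; apply: eq_bigr => i _ /=.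
have := wp_coef_down n i hw => e.
have := wp_pref_down n hw => e'.
transitivity (wp_pref n.+1 w * (wp_coef n.+1 w i *
   ((1 - q ^+ (i + n) * w ^+ 2) * (1 - q ^+ i / q ^+ n.+1))) * y ^+ i * f i).
  by ring.
rewrite e; transitivity (wp_pref n.+1 w * (1 - q ^+ n * w ^+ 2) * 
  (1 - q ^- n.+1) * wp_coef n w i * y ^+ i * f i); first by ring.
by rewrite e'; ring.
Qed.

Lemma wp_sumD n w y f1 f2 :
  wp_sum n w y (fun i => f1 i + f2 i) = wp_sum n w y f1 + wp_sum n w y f2.
Proof.
by rewrite /wp_sum -mulrDr -big_split /=; congr (_ * _); apply: eq_bigr => i _; rewrite mulrDr.
Qed.

Lemma wp_sumZ n w y c f :
  wp_sum n w y (fun i => c * f i) = c * wp_sum n w y f.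
Proof.
by rewrite /wp_sum mulrCA; congr (_ * _); rewrite mulr_sumr; apply: eq_bigr => i _; ring.
Qed.

Lemma eq_wp_sum n w y f1 f2 : f1 =1 f2 -> wp_sum n w y f1 = wp_sum n w y f2.
Proof. by move=> e; rewrite /wp_sum; congr (_ * _); apply: eq_bigr => i _; rewrite e. Qed.

Lemma wp_sumX n w y f :
  wp_sum n w y (fun i => q ^+ i * f i) = wp_sum n w (y * q) f.
Proof.
by rewrite /wp_sum; congr (_ * _); apply: eq_bigr => i _; rewrite exprMn; ring.
Qed.

(** Induction on n. With x = q^i, the quadratic factors in [wp_sum_shift] and [wp_sum_down] have
    equal constant and x^2 coefficients, so their difference is a multiple of x. This x turns the
    argument - q^(n+1) into - q^(n+2), the one required for n + 1, while the two sums being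
    subtracted are known from n. *)
Lemma bailey_daum n w : (forall i : int, w ^+ 2 != q ^ i) ->
  wp_sum n w (- q ^+ n.+1) (fun=> 1) = \prod_(1 <= k < n.+1) (q ^+ k + 1).
Proof.
elim: n w => [|n IHn] w hw.
  rewrite big_geq // /wp_sum big_ord1 /wp_pref /wp_coef !qpoch0 !expr0.
  by rewrite !(mulr1, divr1).
have hqw := w2_shift hw.
have e : wp_sum n.+1 w (- q ^+ n.+1)
     (fun i => (1 - q ^+ i) * (1 - q ^+ i * w ^+ 2 / q) * 1) - 
   wp_sum n.+1 w (- q ^+ n.+1)
     (fun i => (1 - q ^+ (i + n) * w ^+ 2) * (1 - q ^+ i / q ^+ n.+1) * 1)
  = (q ^- n.+1 - 1) * (1 - q ^+ n * w ^+ 2) *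
    wp_sum n.+1 w (- q ^+ n.+2) (fun=> 1).
  have -> : - q ^+ n.+2 = - q ^+ n.+1 * q by rewrite [in LHS]exprSr mulNr.
  rewrite -wp_sumX -[RHS](wp_sumZ n.+1 w _ ((q ^- n.+1 - 1) * (1 - q ^+ n * w ^+ 2))).
  rewrite -[X in _ + X = _]mulN1r -[X in _ + X = _](wp_sumZ n.+1 w _ (-1)) -wp_sumD.
  apply: eq_wp_sum => i.
  have h : q ^+ n != 0 by rewrite expf_neq0.
  rewrite exprD [q ^+ n.+1]exprS; move: (q ^+ n) (q ^+ i) h => a b h.
  by field; rewrite ?h ?q_neq0.
rewrite big_nat_recr //=; move: e; rewrite wp_sum_shift // wp_sum_down // !IHn // => e.
have n1 := qexp_w_neq0 n hw.
have n2 : q ^- n.+1 - 1 != 0 by rewrite subr_eq0 invr_eq1 q_expn.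
apply: (mulfI (mulf_neq0 n2 n1)); rewrite -{}e.
have h : q ^+ n != 0 by rewrite expf_neq0.
rewrite mulnC muln2 -addnn [q ^+ (_ + _).+1]exprS exprD [q ^+ n.+1]exprS.
by move: (q ^+ n) (\prod_(_ <= _ < _) _) h => a b h; field; rewrite ?h ?q_neq0.
Qed.

End BaileyDaum.

(** * The case of unit multiplicities *)

Section PairProducts.
Variables (F : fieldType) (T : finType) (lt : rel T).
Hypothesis lt_irr : irreflexive lt.
Hypothesis lt_tot : forall a b, a != b -> lt a b = ~~ lt b a.
Implicit Types (G : T -> T -> F) (J : {set T}).

Definition pair_prod G J : F := \prod_(a in J) \prod_(b in J | lt a b) G a b.

(** As G is symmetric, x meets every element of J exactly once, whichever of the two comes first. *)
Lemma pair_prodU1 G J x : (forall a b, G a b = G b a) -> x \notin J ->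
  pair_prod G (x |: J) = (\prod_(b in J) G x b) * pair_prod G J.
Proof.
move=> sG xJ; rewrite /pair_prod big_setU1 //=.
have -> : \prod_(b in x |: J | lt x b) G x b = \prod_(b in J | lt x b) G x b.
  apply: eq_bigl => b; rewrite in_setU1; case: eqP => [->|//] /=.
  by rewrite lt_irr andbF.
have -> : \prod_(a in J) \prod_(b in x |: J | lt a b) G a b =
  \prod_(a in J) ((if lt a x then G x a else 1) * \prod_(b in J | lt a b) G a b).
  apply: eq_bigr => a aJ; rewrite big_mkcondr big_setU1 //= -big_mkcondr.
  by rewrite sG.
rewrite big_split /= mulrA -big_mkcondr; congr (_ * _).
rewrite [RHS](bigID (lt x)) /=; congr (_ * _); apply: eq_bigl => a.
case aJ: (a \in J) => //=; apply: lt_tot.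
by apply: contraNneq xJ => <-.
Qed.

Lemma pair_prod0 G : pair_prod G set0 = 1.
Proof. by rewrite /pair_prod big_set0. Qed.

Lemma eq_pair_prod G1 G2 J : {in J &, G1 =2 G2} -> pair_prod G1 J = pair_prod G2 J.
Proof.
move=> e; apply: eq_bigr => a aJ; apply: eq_bigr => b /andP[bJ _]; exact: e.
Qed.

End PairProducts.

Section SubsetSum.
Variables (F : fieldType) (q : F) (T : finType) (lt : rel T).
Hypothesis q_neq0 : q != 0.
Hypothesis q_expn : forall i, (0 < i)%N -> q ^+ i != 1.
Hypothesis q_expn1 : forall i : nat, q ^+ i + 1 != 0.
Hypothesis lt_irr : irreflexive lt.
Hypothesis lt_tot : forall a b, a != b -> lt a b = ~~ lt b a.
Implicit Types (w t : F) (z : T -> F) (J S : {set T}).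

(** The function g of the outline. Its pole at q^(-1) governs the residues, its zero at q^(-2) the
    specialization to blocks. *)
Definition hl_factor (x : F) : F := (1 - q ^+ 2 * x) / (1 - q * x).

Definition side n w (y : F) : F := (1 - w * y) * (1 - q ^+ n * w / (q * y)).

Definition flip z S a : F := if a \in S then (q * z a)^-1 else z a.

Definition flip_term n w z J S : F :=
  pair_prod lt (fun a b => hl_factor (flip z S a * flip z S b)) J
  * \prod_(a in J) side n w (flip z S a).

Definition flip_sum n w z J : F := \sum_(S : {set T} | S \subset J) flip_term n w z J S.

Definition wp_node w z J i : F :=
  \prod_(a in J) ((1 - q ^+ i * w * z a) * (1 - q ^+ i * w / (q * z a))).

Lemma big_subsetU1 (f : {set T} -> F) J x : x \notin J ->
  \sum_(S : {set T} | S \subset x |: J) f S =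
  \sum_(S : {set T} | S \subset J) (f S + f (x |: S)).
Proof.
move=> xJ; rewrite big_split /= (bigID (fun S : {set T} => x \in S)) /= addrC.
congr (_ + _).
  apply: eq_bigl => S; apply/andP/idP => [[sS xS]|sS]; last first.
    split; first by rewrite (subset_trans sS) // subsetUr.
    by apply: contra xJ => /(subsetP sS).
  apply/subsetP => a aS; have := subsetP sS a aS; rewrite in_setU1.
  by case: eqP => [ea|//]; rewrite ea in aS; rewrite aS in xS.
rewrite (reindex_onto (fun S => x |: S) (fun S => S :\ x)); last first.
  by move=> S /andP[_ xS]; rewrite setD1K.
apply: eq_bigl => S; rewrite setU11 andbT; apply/andP/idP => [[s1 /eqP e]|sS].
  have xS : x \notin S by rewrite -e setD11.
  by rewrite -(setU1K xS) -(setU1K xJ) setSD.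
split; first by rewrite setUS.
by rewrite setU1K //; apply: contra xJ => /(subsetP sS).
Qed.

(** * Interpolation in one additional variable t *)

Section Interpolation.
Variables (n : nat) (w : F) (z : T -> F) (J : {set T}).
Hypothesis z_neq0 : forall a, a \in J -> z a != 0.

Local Notation zi S := (flip z S).

(* For an additional variable t, [plusP S] and [minusP S] are the factors by
   which it multiplies [flip_term n w z J S] when it is kept, resp. reflected,
   cleared of denominators by the factor t * denomP(t). *)
Definition denomP : {poly F} :=
  \prod_(b in J) (('X - (z b)%:P) * (1 - (q * z b) *: 'X)).

Definition plusP (S : {set T}) : {poly F} :=
  (1 - w *: 'X) * ('X - (q ^+ n * w / q)%:P) *
  \prod_(b in J) ((1 - (q ^+ 2 * zi S b) *: 'X) * ('X - (zi S b)%:P) * (z b / zi S b)%:P).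

Definition minusP (S : {set T}) : {poly F} :=
  ('X - (w / q)%:P) * (1 - (q ^+ n * w) *: 'X) *
  \prod_(b in J) (('X - (q * zi S b)%:P) * (1 - (q * zi S b) *: 'X) * (z b / zi S b)%:P).

(** At t, this is t times the well-poised sum for J enlarged by the variable t. *)
Definition lhsP (y : F) : {poly F} :=
  \sum_(i < n.+1) (wp_pref q n w * wp_coef q n w i * y ^+ i * wp_node w z J i) *:
     ((1 - (q ^+ i * w) *: 'X) * ('X - (q ^+ i * w / q)%:P)).

Definition rhsP : {poly F} :=
  \sum_(S : {set T} | S \subset J) flip_term n w z J S *: (plusP S + minusP S).

Lemma size_1subZX (c : F) : (size (1 - c *: 'X : {poly F})%R <= 2)%N.
Proof.
rewrite (leq_trans (size_polyD _ _)) // size_polyN geq_max size_poly1 /=.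
by rewrite (leq_trans (size_scale_leq _ _)) // size_polyX.
Qed.

Lemma size_XsubC_le (c : F) : (size ('X - c%:P)%R <= 2)%N.
Proof. by rewrite size_XsubC. Qed.

Lemma size_polyC_le (c : F) : (size (c%:P)%R <= 1)%N.
Proof. by rewrite size_polyC leq_b1. Qed.

#[local] Hint Resolve size_1subZX size_XsubC_le size_polyC_le : core.

Lemma size_polyM_leq (p1 p2 : {poly F}) m1 m2 :
  (size p1 <= m1.+1)%N -> (size p2 <= m2.+1)%N -> (size (p1 * p2)%R <= (m1 + m2).+1)%N.
Proof. by move=> h1 h2; rewrite (leq_trans (size_polyMleq _ _)) //; lia. Qed.

Lemma size_prod_quad (f : T -> {poly F}) :
  (forall a, a \in J -> (size (f a) <= 3)%N) ->
  (size (\prod_(b in J) f b)%R <= (2 * #|J|).+1)%N.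
Proof.
move=> h; rewrite (leq_trans (size_poly_prod_leq _ _)) //.
have : (\sum_(b in J) size (f b) <= \sum_(b in J) 3)%N by apply: leq_sum.
by rewrite sum_nat_const -[#|in_mem^~ _|]/#|J|; lia.
Qed.

Lemma size_denomP : (size denomP <= (2 * #|J|).+1)%N.
Proof. by apply: size_prod_quad => a _; apply: (@size_polyM_leq _ _ 1 1). Qed.

Lemma size_plusP S : (size (plusP S) <= (2 * #|J|).+3)%N.
Proof.
apply: (@size_polyM_leq _ _ 2 _); first exact: (@size_polyM_leq _ _ 1 1).
apply: size_prod_quad => a _; apply: (@size_polyM_leq _ _ 2 0) => //.
exact: (@size_polyM_leq _ _ 1 1).
Qed.

Lemma size_minusP S : (size (minusP S) <= (2 * #|J|).+3)%N.
Proof.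
apply: (@size_polyM_leq _ _ 2 _); first exact: (@size_polyM_leq _ _ 1 1).
apply: size_prod_quad => a _; apply: (@size_polyM_leq _ _ 2 0) => //.
exact: (@size_polyM_leq _ _ 1 1).
Qed.

Lemma size_lhsP (y : F) : (size (lhsP y) <= 3)%N.
Proof.
apply: (leq_trans (size_sum _ _ _)); apply/bigmax_leqP => i _.
by apply: (leq_trans (size_scale_leq _ _)); apply: (@size_polyM_leq _ _ 1 1).
Qed.

Lemma size_rhsP : (size rhsP <= (2 * #|J|).+3)%N.
Proof.
apply: (leq_trans (size_sum _ _ _)); apply/bigmax_leqP => S _.
apply: (leq_trans (size_scale_leq _ _)); apply: (leq_trans (size_polyD _ _)).
by rewrite geq_max size_plusP size_minusP.
Qed.

Lemma denomPE t : denomP.[t] = \prod_(b in J) ((t - z b) * (1 - q * z b * t)).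
Proof.
by rewrite /denomP horner_prod; apply: eq_bigr => b _; rewrite !hornerE.
Qed.

Lemma plusPE S t : (plusP S).[t] =
  (1 - w * t) * (t - q ^+ n * w / q) *
  \prod_(b in J) ((1 - q ^+ 2 * zi S b * t) * (t - zi S b) * (z b / zi S b)).
Proof.
rewrite /plusP hornerM horner_prod; congr (_ * _); first by rewrite !hornerE.
by apply: eq_bigr => b _; rewrite !hornerE.
Qed.

Lemma minusPE S t : (minusP S).[t] =
  (t - w / q) * (1 - q ^+ n * w * t) *
  \prod_(b in J) ((t - q * zi S b) * (1 - q * zi S b * t) * (z b / zi S b)).
Proof.
rewrite /minusP hornerM horner_prod; congr (_ * _); first by rewrite !hornerE.
by apply: eq_bigr => b _; rewrite !hornerE.
Qed.

Lemma lhsPE (y t : F) : (lhsP y).[t] =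
  wp_sum q n w y (fun i => wp_node w z J i *
     ((1 - q ^+ i * w * t) * (t - q ^+ i * w / q))).
Proof.
rewrite /lhsP horner_sum /wp_sum mulr_sumr; apply: eq_bigr => i _.
by rewrite !hornerE; ring.
Qed.

Lemma rhsPE t : rhsP.[t] =
  \sum_(S : {set T} | S \subset J)
     flip_term n w z J S * ((plusP S).[t] + (minusP S).[t]).
Proof. by rewrite /rhsP horner_sum; apply: eq_bigr => S _; rewrite !hornerE. Qed.

Lemma flip_neq0 S b : b \in J -> zi S b != 0.
Proof.
move=> bJ; rewrite /flip; case: ifP => _; last exact: z_neq0.
by rewrite invr_neq0 // mulf_neq0 // z_neq0.
Qed.

(** This is the purpose of the ratio of z_b to its chosen value in [plusP] and [minusP]: it gives
    all choices S the common denominator [denomP]. *)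
Lemma flip_denom S b t : b \in J ->
  (t - zi S b) * (1 - q * zi S b * t) * (z b / zi S b) = (t - z b) * (1 - q * z b * t).
Proof.
move=> bJ; have := z_neq0 bJ; rewrite /flip; case: ifP => _ h; last first.
  by rewrite divff // mulr1.
by field; rewrite ?h ?q_neq0 ?oner_neq0.
Qed.

(** Difference of the two sides for J and t, cleared of denominators; [y] and [c] stay free until
    the induction fixes them. *)
Definition diffP y c : {poly F} := lhsP y * denomP - c *: rhsP.

Lemma size_diffP y c : (size (diffP y c) <= (2 * #|J|).+3)%N.
Proof.
rewrite (leq_trans (size_polyD _ _)) // geq_max size_polyN.
rewrite (leq_trans (size_scale_leq _ _)) ?size_rhsP // andbT.
by rewrite (leq_trans (@size_polyM_leq _ _ 2 _ (size_lhsP y) size_denomP)).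
Qed.

Lemma diffPE y c t : (diffP y c).[t] = (lhsP y).[t] * denomP.[t] - c * rhsP.[t].
Proof. by rewrite !hornerE. Qed.

(* Every ingredient is symmetric under t -> 1 / (q t), up to a power of q t^2. *)
Lemma diffP_reflect y c t : t != 0 ->
  (diffP y c).[(q * t)^-1] = (diffP y c).[t] / (q * t ^+ 2) ^+ #|J|.+1.
Proof.
move=> t0.
have qt : q * t ^+ 2 != 0 by rewrite mulf_neq0 ?expf_neq0.
set X := (q * t ^+ 2)^-1.
have prodX (f g : T -> F) : (forall b, b \in J -> f b = X * g b) ->
    \prod_(b in J) f b = X ^+ #|J| * \prod_(b in J) g b.
  move=> e; rewrite -prodr_const -big_split /=; exact: eq_bigr.
have eD : denomP.[(q * t)^-1] = X ^+ #|J| * denomP.[t].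
  rewrite !denomPE; apply: prodX => b _; rewrite /X.
  by field; rewrite ?oner_neq0 ?t0 ?q_neq0.
have eL : (lhsP y).[(q * t)^-1] = X * (lhsP y).[t].
  rewrite !lhsPE -[RHS](wp_sumZ q n w y X); apply: eq_wp_sum => i.
  by rewrite /X; field; rewrite ?oner_neq0 ?t0 ?q_neq0.
have eP S : (plusP S).[(q * t)^-1] = X ^+ #|J|.+1 * (minusP S).[t].
  rewrite plusPE minusPE [X ^+ _.+1]exprS [RHS]mulrACA; congr (_ * _).
    by rewrite /X; field; rewrite ?oner_neq0 ?t0 ?q_neq0.
  apply: prodX => b bJ; have := flip_neq0 S bJ => h.
  by rewrite /X; field; rewrite ?oner_neq0 ?t0 ?q_neq0 ?h.
have eM S : (minusP S).[(q * t)^-1] = X ^+ #|J|.+1 * (plusP S).[t].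
  rewrite plusPE minusPE [X ^+ _.+1]exprS [RHS]mulrACA; congr (_ * _).
    by rewrite /X; field; rewrite ?oner_neq0 ?t0 ?q_neq0.
  apply: prodX => b bJ; have := flip_neq0 S bJ => h.
  by rewrite /X; field; rewrite ?oner_neq0 ?t0 ?q_neq0 ?h.
have eR : rhsP.[(q * t)^-1] = X ^+ #|J|.+1 * rhsP.[t].
  rewrite !rhsPE mulr_sumr; apply: eq_bigr => S _; rewrite eP eM; ring.
rewrite -exprVn -/X !diffPE eD eL eR [X ^+ _.+1]exprS; ring.
Qed.

Hypothesis z_inj : {in J &, forall a b, a != b -> z a != z b}.
Hypothesis z_recip : {in J &, forall a b, q * z a * z b != 1}.

(** At t = 0 the left side gains a factor q^i, which moves the argument to y q. On the right, up to
    a common factor, keeping t gives q^n and reflecting it gives q^|J|. *)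
Lemma diffP_root0 y c :
  wp_sum q n w (y * q) (wp_node w z J) = c * (q ^+ n + q ^+ #|J|) * flip_sum n w z J ->
  (diffP y c).[0] = 0.
Proof.
move=> e; rewrite diffPE.
have -> : (lhsP y).[0] = - (w / q) * wp_sum q n w (y * q) (wp_node w z J).
  by rewrite lhsPE -wp_sumX -wp_sumZ; apply: eq_wp_sum => i; ring.
have -> : rhsP.[0] = - (w / q) * (q ^+ n + q ^+ #|J|) * denomP.[0] * flip_sum n w z J.
  rewrite rhsPE /flip_sum mulr_sumr; apply: eq_bigr => S _; rewrite mulrC; congr (_ * _).
  rewrite plusPE minusPE.
  have -> : \prod_(b in J) ((0 - q * zi S b) * (1 - q * zi S b * 0) * (z b / zi S b))
     = q ^+ #|J| * denomP.[0].
    rewrite denomPE -prodr_const -big_split; apply: eq_bigr => b bJ /=.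
    by rewrite -(flip_denom S) //; ring.
  have -> : \prod_(b in J) ((1 - q ^+ 2 * zi S b * 0) * (0 - zi S b) * (z b / zi S b))
     = denomP.[0].
    by rewrite denomPE; apply: eq_bigr => b bJ; rewrite -(flip_denom S) //; ring.
  ring.
by rewrite e; ring.
Qed.

Lemma flip_prod_denom S t :
  \prod_(b in J) ((t - zi S b) * (1 - q * zi S b * t) * (z b / zi S b)) = denomP.[t].
Proof. by rewrite denomPE; apply: eq_bigr => b bJ; rewrite flip_denom. Qed.

(** Pair S with c |: S. At t = z_c a term survives only if exactly one of t and z_c is reflected.
    The two surviving terms arise from each other by exchanging t and z_c, and they cancel. *)
Lemma rhsP_residue c : c \in J -> rhsP.[z c] = 0.
Proof.
move=> cJ; rewrite rhsPE.
have cJ' : c \notin J :\ c by rewrite setD11.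
rewrite -{1}(setD1K cJ) big_subsetU1 // big1 // => S sS.
have cS : c \notin S by apply: contra cJ' => /(subsetP sS).
have zc := z_neq0 cJ.
have zS : zi S c = z c by rewrite /flip (negbTE cS).
have zU : zi (c |: S) c = (q * z c)^-1 by rewrite /flip setU11.
have zUb b : b \in J :\ c -> zi (c |: S) b = zi S b.
  by rewrite in_setD1 => /andP[bc _]; rewrite /flip in_setU1 (negbTE bc).
have -> : (plusP S).[z c] = 0.
  by rewrite plusPE (bigD1 c) //= zS subrr mulr0 !mul0r mulr0.
have -> : (minusP (c |: S)).[z c] = 0.
  rewrite minusPE (bigD1 c) //= zU.
  have -> : 1 - q * (q * z c)^-1 * z c = 0 by field; rewrite q_neq0 zc.
  by rewrite mulr0 !mul0r mulr0.
rewrite add0r addr0.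
pose C := pair_prod lt (fun a b => hl_factor (zi S a * zi S b)) (J :\ c)
  * \prod_(a in J :\ c) side n w (zi S a).
(* Isolates the index c for any values that agree with the choice S away from c, which covers both S
   and c |: S. *)
have gC (y : T -> F) : {in J :\ c, y =1 zi S} ->
   pair_prod lt (fun a b => hl_factor (y a * y b)) J * \prod_(a in J) side n w (y a)
   = C * side n w (y c) * \prod_(b in J :\ c) hl_factor (y c * zi S b).
  move=> ey; rewrite -{1 2}(setD1K cJ) pair_prodU1 //; last first.
    by move=> a b; rewrite mulrC.
  rewrite big_setU1 //= /C.
  rewrite (@eq_pair_prod _ _ lt _ (fun a b => hl_factor (zi S a * zi S b))); last first.
    by move=> a b aJ bJ; rewrite !ey.
  rewrite (eq_bigr (fun b => hl_factor (y c * zi S b))); last first.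
    by move=> b bJ; rewrite (ey b).
  rewrite [X in _ * (_ * X)](eq_bigr (fun b => side n w (zi S b))); last first.
    by move=> b bJ; rewrite (ey b).
  by ring.
rewrite /flip_term gC // gC //.
rewrite minusPE plusPE (bigD1 c cJ) [X in _ + _ * (_ * X)](bigD1 c cJ) /=.
have eJ : (fun i => (i \in J) && (i != c)) =1 (fun i => i \in J :\ c).
  by move=> i; rewrite in_setD1 andbC.
rewrite !(eq_bigl _ _ eJ) zS zU.
set P1 := \prod_(b in _) hl_factor _; set P2 := \prod_(b in _) (_ * _ * _).
set P3 := \prod_(b in _) hl_factor _; set P4 := \prod_(b in _) (_ * _ * _).
(* For each remaining b, with chosen value p_b, both sides are g(z_c p_b) g(p_b / (q z_c)) times the
   same denominator. *)
have e : P1 * P2 = P3 * P4.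
  rewrite -!big_split; apply: eq_bigr => b bJ' /=; rewrite zUb //.
  move: (bJ'); rewrite in_setD1 => /andP[bc bJ].
  have zb := flip_neq0 S bJ.
  have h1 : 1 - q * z c * zi S b != 0.
    rewrite /flip; case: ifP => _; last by rewrite subr_eq0 eq_sym z_recip.
    have -> : 1 - q * z c / (q * z b) = (z b - z c) / z b.
      by field; rewrite q_neq0 z_neq0.
    by rewrite mulf_neq0 ?invr_neq0 ?z_neq0 // subr_eq0 z_inj.
  have h2 : z c - zi S b != 0.
    rewrite /flip; case: ifP => _; last by rewrite subr_eq0 z_inj // eq_sym.
    have -> : z c - (q * z b)^-1 = (q * z c * z b - 1) / (q * z b).
      by field; rewrite q_neq0 z_neq0.
    by rewrite mulf_neq0 ?invr_neq0 ?mulf_neq0 ?z_neq0 // subr_eq0 z_recip.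
  move: h1 h2 zb; rewrite /hl_factor; move: (zi S b) => x h1 h2 zb.
  by field; rewrite [q * (_ * x)]mulrA ?h1 ?h2 ?zb ?zc ?q_neq0 ?oner_neq0.
rewrite /side; move: e; clear gC; move: P1 P2 P3 P4 C => P1 P2 P3 P4 C e.
by field: e; rewrite zc q_neq0 oner_neq0.
Qed.

End Interpolation.

(** At t = w / q, the factor g(t p) equals (1 - q w p) / (1 - w p), which replaces w by q w in the
    first half of [side]. The second half depends only on q^(n+1) w = q^n (q w). *)
Lemma flip_term_shift n w z J S : (forall a, a \in J -> z a != 0) ->
  flip_term n.+1 w z J S *
    \prod_(b in J) ((1 - q ^+ 2 * flip z S b * (w / q)) * (w / q - flip z S b)
                    * (z b / flip z S b))
  = flip_term n (q * w) z J S * (denomP z J).[w / q].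
Proof.
move=> z0; rewrite /flip_term -!mulrA; congr (_ * _).
rewrite -(flip_prod_denom z0 S) -!big_split; apply: eq_bigr => b bJ /=.
have h := flip_neq0 z0 S bJ; rewrite /side [q ^+ n.+1]exprS.
by field; rewrite ?h ?q_neq0 ?oner_neq0.
Qed.

Lemma wp_node_shift w z J i : wp_node w z J i.+1 = wp_node (q * w) z J i.
Proof. by apply: eq_bigr => a _; rewrite exprSr !mulrA. Qed.

(** For n = 0 both sides are divisible by t - w / q. *)
Lemma diffP_root_w0 w z J y c : (forall a, a \in J -> z a != 0) ->
  (diffP 0 w z J y c).[w / q] = 0.
Proof.
move=> z0; rewrite diffPE.
have -> : (lhsP 0 w z J y).[w / q] = 0.
  by rewrite lhsPE /wp_sum big_ord1 /= expr0 !mul1r subrr !mulr0.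
have -> : (rhsP 0 w z J).[w / q] = 0.
  rewrite rhsPE big1 // => S _; rewrite plusPE minusPE expr0 mul1r.
  by rewrite subrr !(mulr0, mul0r) addr0 mulr0.
by rewrite mul0r mulr0 subr0.
Qed.

(** At t = w / q the reflected terms vanish, and the factor of t on the left becomes (w / q) (1 -
    q^i) (1 - q^i w^2 / q), to which [wp_sum_shift] applies. *)
Lemma diffP_root_w n w z J y c : (forall a, a \in J -> z a != 0) ->
  (forall i : int, w ^+ 2 != q ^ i) ->
  (1 - q ^- n.+1) * y * wp_sum q n (q * w) y (wp_node (q * w) z J)
    = c * (1 - q ^+ n.+1) * flip_sum n (q * w) z J ->
  (diffP n.+1 w z J y c).[w / q] = 0.
Proof.
move=> z0 hw e; rewrite diffPE.
have -> : (lhsP n.+1 w z J y).[w / q] = (w / q) * ((1 - w ^+ 2 / q) * (1 - q ^- n.+1)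
   * y * wp_sum q n (q * w) y (wp_node (q * w) z J)).
  rewrite lhsPE.
  have -> : wp_sum q n (q * w) y (wp_node (q * w) z J)
         = wp_sum q n (q * w) y (fun i => wp_node w z J i.+1).
    by apply: eq_wp_sum => i; rewrite wp_node_shift.
  rewrite -wp_sum_shift // -wp_sumZ; apply: eq_wp_sum => i; ring.
have -> : (rhsP n.+1 w z J).[w / q] =
   (w / q) * (1 - w ^+ 2 / q) * (1 - q ^+ n.+1) * (denomP z J).[w / q]
   * flip_sum n (q * w) z J.
  rewrite rhsPE /flip_sum mulr_sumr; apply: eq_bigr => S _.
  rewrite plusPE minusPE subrr !mul0r addr0 mulrCA flip_term_shift //.
  by ring.
rewrite -[w / q * (1 - w ^+ 2 / q) * _]mulrA.
set D := (denomP _ _).[_].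
transitivity (w / q * (1 - w ^+ 2 / q) * D *
  ((1 - q ^- n.+1) * y * wp_sum q n (q * w) y (wp_node (q * w) z J)
  - c * (1 - q ^+ n.+1) * flip_sum n (q * w) z J)); first by ring.
by rewrite e subrr mulr0.
Qed.

(** Root count: 0, the points w / q and z_a, and the reflections of these points are 2 |J| + 3
    distinct roots, while the degree is at most 2 |J| + 2. *)
Lemma diffP_eq0 n w z J y c : (forall a, a \in J -> z a != 0) ->
  {in J &, forall a b, a != b -> z a != z b} ->
  {in J &, forall a b, q * z a * z b != 1} ->
  w != 0 -> w ^+ 2 != q -> {in J, forall a, w * z a != 1} ->
  {in J, forall a, w != q * z a} ->
  (diffP n w z J y c).[0] = 0 -> (diffP n w z J y c).[w / q] = 0 ->
  diffP n w z J y c = 0.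
Proof.
move=> z0 zi zr w0 w2 wz wz' r0 rw; apply/eqP; apply: contraT => nz.
pose zs := [seq z a | a <- enum J].
pose rec (t : F) := (q * t)^-1.
pose rs := 0 :: (w / q :: zs) ++ map rec (w / q :: zs).
have nz' : {in w / q :: zs, forall t, t != 0}.
  move=> t; rewrite inE => /orP[/eqP ->|/mapP[a]].
    by rewrite mulf_neq0 ?invr_neq0.
  by rewrite mem_enum => aJ ->; apply: z0.
have rt : {in w / q :: zs, forall t, (diffP n w z J y c).[t] = 0}.
  move=> t; rewrite inE => /orP[/eqP -> //|/mapP[a]].
  rewrite mem_enum => aJ ->; rewrite diffPE rhsP_residue //.
  by rewrite denomPE (bigD1 a) //= subrr !mul0r !mulr0 subr0.
have roots : all (root (diffP n w z J y c)) rs.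
  apply/allP => t; rewrite inE mem_cat => /orP[/eqP ->|/orP[tz|/mapP[t' tz ->]]].
  - exact/rootP.
  - exact/rootP/rt.
  by apply/rootP; rewrite diffP_reflect ?nz' // rt // mul0r.
have recP t t' : t != 0 -> t' != 0 -> t = rec t' -> q * t * t' = 1.
  by move=> h h' ->; rewrite /rec; field; rewrite h' q_neq0.
have uz : uniq (w / q :: zs).
  rewrite /= map_inj_in_uniq ?enum_uniq ?andbT.
    apply/mapP => -[a]; rewrite mem_enum => aJ e.
    by have /eqP := wz' a aJ; apply; rewrite -e mulrC divfK.
  move=> a b; rewrite !mem_enum => aJ bJ e; apply/eqP; apply: contraT => ab.
  by rewrite -(negbTE (zi a b aJ bJ ab)) e eqxx.
(* Among w / q and the z_a, no point is the reflection of another one or of itself. *)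
have cross : {in w / q :: zs &, forall t t', q * t * t' != 1}.
  have h1 : q * (w / q) * (w / q) != 1.
    apply: contra w2 => /eqP h; apply/eqP; rewrite -[q]mulr1 -h.
    by field; rewrite q_neq0.
  have h2 a : a \in J -> q * (w / q) * z a != 1.
    by move=> aJ; rewrite [q * _]mulrC divfK // wz.
  move=> t t'; rewrite !inE => /orP[/eqP ->|/mapP[a aJ ->]] /orP[/eqP ->|/mapP[b bJ ->]] //.
  - by apply: h2; rewrite -mem_enum.
  - by rewrite mulrAC; apply: h2; rewrite -mem_enum.
  by apply: zr; rewrite -mem_enum.
have uniq_rs : uniq rs.
  rewrite /rs cons_uniq cat_uniq uz map_inj_in_uniq ?uz; last first.
    move=> t t' _ _ /invr_inj h; exact: (mulfI q_neq0).
  rewrite andbT andTb; apply/andP; split.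
    rewrite mem_cat negb_or; apply/andP; split.
      by apply/negP => /nz'; rewrite eqxx.
    apply/mapP => -[t /nz' t0 /eqP].
    by rewrite eq_sym invr_eq0 mulf_eq0 (negbTE q_neq0) (negbTE t0).
  apply/hasPn => t' /mapP[t ti ->]; apply/negP => ri.
  have /eqP := cross _ _ ri ti; apply; apply: recP => //; exact: nz'.
have := leq_trans (max_poly_roots nz roots uniq_rs) (size_diffP _ _ _ _ _ _).
rewrite /rs /= size_cat /= !size_map -cardE; lia.
Qed.

(** The conditions on z serve the root count. Those on w are imposed for all powers of q, so that
    they survive the passage from w to q w in the induction. *)
Record generic_params w z J : Prop := GenericParams {
  gen_z0 : forall a, a \in J -> z a != 0;
  gen_zi : {in J &, forall a b, a != b -> z a != z b};
  gen_zr : {in J &, forall a b, q * z a * z b != 1};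
  gen_w0 : w != 0;
  gen_w2 : forall i : int, w ^+ 2 != q ^ i;
  gen_wz : forall (i : int) a, a \in J -> w * z a != q ^ i;
  gen_wz' : forall (i : int) a, a \in J -> w != q ^ i * z a }.

Lemma generic_shift w z J : generic_params w z J -> generic_params (q * w) z J.
Proof.
have X i : q * q ^ (i - 1) = q ^ i.
  by rewrite -{1}[q]expr1z -expfzDr //; congr (_ ^ _); lia.
case=> h1 h2 h3 h4 h5 h6 h7; split=> //.
- by rewrite mulf_neq0.
- exact: w2_shift.
- move=> i a aJ; rewrite -mulrA -X (inj_eq (mulfI q_neq0)); exact: h6.
- move=> i a aJ; rewrite -X -mulrA (inj_eq (mulfI q_neq0)); exact: h7.
Qed.

Lemma generic_sub w z J J' : J' \subset J -> generic_params w z J -> generic_params w z J'.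
Proof.
move=> /subsetP s [h1 h2 h3 h4 h5 h6 h7]; split=> //.
- by move=> a /s; apply: h1.
- by move=> a b /s aJ /s bJ; apply: h2.
- by move=> a b /s aJ /s bJ; apply: h3.
- by move=> i a /s; apply: h6.
- by move=> i a /s; apply: h7.
Qed.

Theorem wp_flip_sum n w z J : generic_params w z J ->
  wp_sum q n w (- q ^ (n%:Z - #|J|%:Z + 1)) (wp_node w z J) =
  q ^- 'C(#|J|, 2) * qpochN q (n%:Z - #|J|%:Z) * flip_sum n w z J.
Proof.
(* Induction on a strict bound for |J|, with n and w general, since the root w / q leads to n - 1
   and q w. *)
elim: {J}_.+1 {-2}J (ltnSn #|J|) n w => // N IHN J JN n w gen.
have [->|[x xJ]] := set_0Vmem J.
  rewrite cards0 (_ : 'C(0, 2) = 0%N) // expr0 invr1 mul1r.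
  rewrite (_ : n%:Z - 0%N%:Z + 1 = n.+1%:Z); last by lia.
  rewrite (_ : n%:Z - 0%N%:Z = n%:Z); last by lia.
  have -> : flip_sum n w z set0 = 1.
    rewrite /flip_sum (eq_bigl (pred1 set0)); last by move=> S; rewrite subset0.
    by rewrite big_pred1_eq /flip_term pair_prod0 big_set0 mulr1.
  rewrite mulr1 -[qpochN _ _]/(\prod_(1 <= k < n.+1) (q ^+ k + 1)).
  rewrite -(bailey_daum q_neq0 q_expn n (gen_w2 gen)).
  by apply: eq_wp_sum => i; rewrite /wp_node big_set0.
pose J' := J :\ x.
have xJ' : x \notin J' by rewrite setD11.
have sJ : J' \subset J by rewrite subsetDl.
have eJ : J = x |: J' by rewrite setD1K.
have cJ : #|J| = #|J'|.+1 by rewrite eJ cardsU1 xJ'.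
have gen' := generic_sub sJ gen.
have IH m v : generic_params v z J' -> wp_sum q m v (- q ^ (m%:Z - #|J'|%:Z + 1)) (wp_node v z J') =
  q ^- 'C(#|J'|, 2) * qpochN q (m%:Z - #|J'|%:Z) * flip_sum m v z J'.
  by apply: IHN; rewrite -ltnS -cJ.
set c := q ^- 'C(#|J|, 2) * qpochN q (n%:Z - #|J|%:Z).
set y := - q ^ _.
have q0N : {morph (fun i : int => q ^ i) : a b / a + b >-> a * b} by move=> a b; rewrite expfzDr.
(* Pascal's rule and q^n + q^|J'| = q^|J'| (q^(n - |J'|) + 1) produce the constant for one variable
   less. *)
have cE : c * (q ^+ n + q ^+ #|J'|) = q ^- 'C(#|J'|, 2) * qpochN q (n%:Z - #|J'|%:Z).
  have -> : n%:Z - #|J'|%:Z = n%:Z - #|J|%:Z + 1 by rewrite cJ; lia.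
  rewrite qpochN_succ // /c cJ binS bin1 exprD.
  have -> : n%:Z - #|J'|.+1%:Z + 1 = n%:Z - #|J'|%:Z by lia.
  rewrite expfzDr // -exprnN -[q ^ n%:Z]/(q ^+ n).
  have h1 : q ^+ 'C(#|J'|, 2) != 0 by rewrite expf_neq0.
  have h2 : q ^+ #|J'| != 0 by rewrite expf_neq0.
  move: (q ^+ n) (qpochN q _) h1 h2; move: (q ^+ #|J'|) (q ^+ _) => a b d e h1 h2.
  by field; rewrite h1 h2.
have yq : y * q = - q ^ (n%:Z - #|J'|%:Z + 1).
  rewrite /y mulNr; congr (- _); rewrite -{2}[q]expr1z -expfzDr //; congr (_ ^ _).
  by rewrite cJ; lia.
have r0 : (diffP n w z J' y c).[0] = 0.
  by apply: diffP_root0; [exact: gen_z0 gen' | rewrite yq IH // cE].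
have rw : (diffP n w z J' y c).[w / q] = 0.
  case: n @c @y cE yq r0 => [|m] c y cE yq r0; first exact/diffP_root_w0/(gen_z0 gen').
  apply: diffP_root_w; [exact: gen_z0 gen' | exact: gen_w2 gen |].
  (* Lowering n and |J| together leaves the argument unchanged. *)
  have ey : y = - q ^ (m%:Z - #|J'|%:Z + 1).
    by rewrite /y; congr (- _ ^ _); rewrite cJ; lia.
  rewrite {2}ey IH; last exact: generic_shift.
  rewrite {1}ey /c; have -> : m.+1%:Z - #|J|%:Z = m%:Z - #|J'|%:Z by rewrite cJ; lia.
  rewrite cJ binS bin1 exprD expfzDr // expfzDr // -exprnN expr1z [q ^+ m.+1]exprS.
  have h1 : q ^+ 'C(#|J'|, 2) != 0 by rewrite expf_neq0.
  have h2 : q ^+ #|J'| != 0 by rewrite expf_neq0.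
  have h3 : q ^+ m != 0 by rewrite expf_neq0.
  rewrite -[q ^ m%:Z]/(q ^+ m).
  move: (q ^+ m) (qpochN q _) h1 h2 h3.
  move: (q ^+ #|J'|) (q ^+ _) (flip_sum _ _ _ _) => a b d e f h1 h2 h3.
  by field; rewrite h1 h2 h3 q_neq0.
have := @diffP_eq0 n w z J' y c (gen_z0 gen') (gen_zi gen') (gen_zr gen') (gen_w0 gen').
have -> : w ^+ 2 != q by have := gen_w2 gen 1; rewrite expr1z.
have h1 : {in J', forall a, w * z a != 1}.
  by move=> a aJ; have := gen_wz gen' 0 aJ; rewrite expr0z.
have h2 : {in J', forall a, w != q * z a}.
  by move=> a aJ; have := gen_wz' gen' 1 aJ; rewrite expr1z.
move=> /(_ isT h1 h2 r0 rw) P0.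
have zx := gen_z0 gen xJ.
have D0 : (denomP z J').[z x] != 0.
  rewrite denomPE; apply/prodf_neq0 => b bJ.
  move: (bJ); rewrite in_setD1 => /andP[bx bJ'].
  rewrite mulf_neq0 // subr_eq0; first by rewrite (gen_zi gen) // eq_sym.
  by rewrite eq_sym (gen_zr gen).
(* Multiplied by z_x and by the denominator at z_x, the claim for J is the vanishing of [diffP] over
   J' at t = z_x. *)
apply: (mulfI (mulf_neq0 zx D0)); apply/eqP; rewrite -subr_eq0; apply/eqP.
transitivity (diffP n w z J' y c).[z x]; last by rewrite P0 horner0.
rewrite diffPE; congr (_ - _).
  rewrite lhsPE mulrAC -wp_sumZ; congr (_ * _); apply: eq_wp_sum => i.
  rewrite [wp_node w z J i]/wp_node [in LHS]eJ big_setU1 //= -/(wp_node w z J' i).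
  by field; rewrite zx q_neq0.
rewrite mulrCA; congr (_ * _); rewrite rhsPE /flip_sum mulr_sumr.
rewrite [in LHS]eJ big_subsetU1 //=; apply: eq_bigr => S sS.
have xS : x \notin S by apply: contra xJ' => /(subsetP sS).
rewrite -mulrDr.
pose pl := \prod_(b in J') hl_factor (z x * flip z S b).
pose mi := \prod_(b in J') hl_factor ((q * z x)^-1 * flip z S b).
(* Splits off x with value p, which is either z_x or its reflection. *)
have gx S' (p : F) : flip z S' x = p -> {in J', flip z S' =1 flip z S} ->
   flip_term n w z (x |: J') S' = side n w p *
     (\prod_(b in J') hl_factor (p * flip z S b)) * flip_term n w z J' S.
  move=> ex ey; rewrite /flip_term pair_prodU1 //; last by move=> a b; rewrite mulrC.
  rewrite big_setU1 //= ex.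
  rewrite (@eq_pair_prod _ _ lt _ (fun a b => hl_factor (flip z S a * flip z S b))); last first.
    by move=> a b aJ bJ; rewrite !ey.
  rewrite (eq_bigr (fun b => hl_factor (p * flip z S b))); last first.
    by move=> b bJ; rewrite (ey b).
  rewrite [X in _ * (side n w p * X)](eq_bigr (fun b => side n w (flip z S b))); last first.
    by move=> b bJ; rewrite (ey b).
  by ring.
rewrite (gx S (z x)) ?(gx (x |: S) (q * z x)^-1) //; last 3 first.
- by rewrite /flip setU11.
- move=> b; rewrite in_setD1 => /andP[bx _].
  by rewrite /flip in_setU1 (negbTE bx).
- by rewrite /flip (negbTE xS).
rewrite -/pl -/mi -mulrDl mulrA mulrC; congr (_ * _).
rewrite plusPE minusPE mulrDr.
have flip_nz b : b \in J' -> 1 - q * z x * flip z S b != 0 /\ z x - flip z S b != 0.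
  rewrite in_setD1 => /andP[bx bJ].
  have zb := gen_z0 gen bJ; rewrite /flip; case: ifP => _; split.
  - have -> : 1 - q * z x / (q * z b) = (z b - z x) / z b by field; rewrite q_neq0 zb.
    by rewrite mulf_neq0 ?invr_neq0 // subr_eq0 (gen_zi gen).
  - have -> : z x - (q * z b)^-1 = (q * z x * z b - 1) / (q * z b).
      by field; rewrite q_neq0 zb.
    by rewrite mulf_neq0 ?invr_neq0 ?mulf_neq0 // subr_eq0 (gen_zr gen).
  - by rewrite subr_eq0 eq_sym (gen_zr gen).
  by rewrite subr_eq0 (gen_zi gen) // eq_sym.
have fz b := @flip_neq0 z J' (gen_z0 gen') S b.
congr (_ + _).
  rewrite -(flip_prod_denom (gen_z0 gen') S).
  have -> : \prod_(b in J')
      ((1 - q ^+ 2 * flip z S b * z x) * (z x - flip z S b) * (z b / flip z S b))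
    = pl * \prod_(b in J') ((z x - flip z S b) * (1 - q * flip z S b * z x) * (z b / flip z S b)).
    rewrite -big_split; apply: eq_bigr => b bJ /=.
    have [g1 g2] := flip_nz b bJ; have := fz b bJ; move: g1 g2; rewrite /hl_factor.
    by move: (flip z S b) => u g1 g2 g3; field; rewrite [q * (_ * u)]mulrA ?g1 ?g2 ?g3.
  by rewrite /side; field; rewrite zx q_neq0.
rewrite -(flip_prod_denom (gen_z0 gen') S).
have -> : \prod_(b in J') ((z x - q * flip z S b) * (1 - q * flip z S b * z x) * (z b / flip z S b))
  = mi * \prod_(b in J') ((z x - flip z S b) * (1 - q * flip z S b * z x) * (z b / flip z S b)).
  rewrite -big_split; apply: eq_bigr => b bJ /=.
  have [g1 g2] := flip_nz b bJ; have := fz b bJ; move: g1 g2; rewrite /hl_factor.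
  by move: (flip z S b) => u g1 g2 g3; field; rewrite ?g1 ?g2 ?g3 ?zx ?q_neq0 ?oner_neq0.
by rewrite /side; field; rewrite zx q_neq0 oner_neq0.
Qed.

End SubsetSum.

(** * Specialization to geometric progressions *)

Section Blocks.
Variables (F : fieldType) (q : F).
Hypothesis q_neq0 : q != 0.
Hypothesis q_expn : forall i, (0 < i)%N -> q ^+ i != 1.
Implicit Types (a r u : F).

Local Notation hl := (hl_factor q).

Lemma qX_neq0 i : q ^+ i != 0. Proof. exact: expf_neq0. Qed.

(** Stable under inversion and under multiplication by powers of q, so one such condition keeps a
    whole family of denominators nonzero. *)
Definition off_lattice (c : F) := forall i : int, c != q ^ i.

Lemma off_lattice_neq c i j : off_lattice c -> q ^+ i * c != q ^+ j.
Proof.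
move=> h; apply: contra (h (j%:Z - i%:Z)) => /eqP e.
by rewrite expfzDr // -exprnN -[q ^ j%:Z]/(q ^+ j) -e mulrAC divff ?mul1r ?qX_neq0.
Qed.

Lemma off_lattice_sub c i j : off_lattice c -> q ^+ i * c - q ^+ j != 0.
Proof. by move=> h; rewrite subr_eq0 off_lattice_neq. Qed.

Lemma off_lattice_1sub c i : off_lattice c -> 1 - q ^+ i * c != 0.
Proof. by move=> h; rewrite subr_eq0 eq_sym (off_lattice_neq i 0 h). Qed.

Lemma off_lattice_inv c : off_lattice c -> off_lattice c^-1.
Proof. by move=> h i; rewrite -[c^-1 == _](inj_eq invr_inj) invrK invr_expz h. Qed.

Lemma off_lattice_mul c i : off_lattice c -> off_lattice (q ^+ i * c).
Proof.
move=> h j; apply: contra (h (j - i%:Z)) => /eqP e.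
by rewrite expfzDr // -e -exprnN mulrAC divff ?mul1r ?qX_neq0.
Qed.

Lemma off_lattice_qpoch c i m : off_lattice c -> qpoch (q ^+ i * c) q m != 0.
Proof.
by move=> h; apply: qpoch_neq0 => l _; rewrite mulrAC -exprD (off_lattice_neq _ 0 h).
Qed.

Lemma off_lattice_qpoch0 c m : off_lattice c -> qpoch c q m != 0.
Proof. by move=> h; have := off_lattice_qpoch 0 m h; rewrite mul1r. Qed.

(** Telescopes, because the numerator of g at x is its denominator at q x. The same reason gives the
    ascending version. *)
Lemma prod_hl_down u m : (forall j, (j <= m)%N -> 1 - q * u / q ^+ j != 0) ->
  \prod_(0 <= j < m) hl (u / (q * q ^+ j)) = (1 - q * u) / (1 - q * u / q ^+ m).
Proof.
elim: m => [|m IH] h.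
  by rewrite big_geq // divr1 divff //; have := h 0%N isT; rewrite divr1.
rewrite big_nat_recr //= IH; last by move=> j jm; apply: h; apply: leqW.
have h1 := h m (leqnSn m); have h2 := h m.+1 (leqnn _).
rewrite /hl_factor.
have -> : q ^+ 2 * (u / (q * q ^+ m)) = q * u / q ^+ m.
  by field; rewrite q_neq0 qX_neq0.
have -> : q * (u / (q * q ^+ m)) = q * u / q ^+ m.+1.
  by rewrite [q ^+ m.+1]exprS; field; rewrite q_neq0 qX_neq0.
by move: (q * u / q ^+ m) (q * u / q ^+ m.+1) h1 h2 => *; field; apply/andP.
Qed.

Lemma prod_hl_up a m k : (m <= k)%N -> (forall j, 1 - q ^+ j.+1 * a != 0) ->
  \prod_(m <= j < k) hl (q ^+ j * a) = (1 - q ^+ k.+1 * a) / (1 - q ^+ m.+1 * a).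
Proof.
move=> mk h; elim: k mk => [|k IH]; first by rewrite leqn0 => /eqP ->; rewrite big_geq // divff.
rewrite leq_eqVlt => /orP[/eqP ->|mk]; first by rewrite big_geq // divff.
rewrite big_nat_recr //= IH // /hl_factor.
have h1 := h k; have h2 := h m; move: h1 h2.
have -> : q ^+ 2 * (q ^+ k * a) = q ^+ k.+2 * a by rewrite mulrA -exprD.
have -> : q * (q ^+ k * a) = q ^+ k.+1 * a by rewrite mulrA -exprS.
by move: (q ^+ _ * a) (q ^+ _ * a) (q ^+ _ * a) => *; field; apply/andP.
Qed.


(** Point j of the block with base z when the first m points of the block are reflected. *)
Definition node m (z : F) j : F := if (j < m)%N then (q * (q ^+ j * z))^-1 else q ^+ j * z.

Lemma prod_hl_node u (z : F) m k : (m <= k)%N -> z != 0 ->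
  (forall j, 1 - q ^+ j.+1 * (u * z) != 0) ->
  (forall j, (j <= m)%N -> 1 - q * (u / z) / q ^+ j != 0) ->
  \prod_(0 <= j < k) hl (u * node m z j) =
  (1 - q ^+ k.+1 * (u * z)) / (1 - q ^+ m.+1 * (u * z))
  * ((1 - q * (u / z)) / (1 - q * (u / z) / q ^+ m)).
Proof.
move=> mk z0 h1 h2; rewrite (big_cat_nat (n := m)) //= mulrC.
rewrite -(prod_hl_up mk h1) -(prod_hl_down h2); congr (_ * _).
  apply: eq_big_nat => j /andP[mj _]; rewrite /node ltnNge mj /=.
  by congr hl_factor; ring.
apply: eq_big_nat => j /andP[_ jm]; rewrite /node jm.
by congr hl_factor; field; rewrite z0 q_neq0 qX_neq0.
Qed.

(** What two distinct blocks contribute to the prefactor and to c_m, in terms of the product a and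
    the ratio r of their bases. *)
Definition pair_target a r k k' m m' : F :=
  qpoch (q ^+ (k' + 1) * a) q k / qpoch (q * a) q k
  * ((q ^+ m * r - q ^+ m') / (r - 1)) * ((1 - q ^+ (m + m') * a) / (1 - a))
  * (qpoch (q ^- k' * r) q m / qpoch (q * r) q m)
  * (qpoch (q ^- k / r) q m' / qpoch (q / r) q m')
  * (qpoch a q m / qpoch (q ^+ (1 + k') * a) q m)
  * (qpoch a q m' / qpoch (q ^+ (1 + k) * a) q m').

Lemma qpoch_shift c m : qpoch c q m * (1 - c * q ^+ m) = (1 - c) * qpoch (q * c) q m.
Proof. by rewrite -qpochS qpochSl [c * q]mulrC. Qed.

Lemma qpoch_down c i m : off_lattice c -> qpoch (q ^+ i * c) q m =
  (1 - q ^+ i * c) / (1 - q ^+ (i + m) * c) * qpoch (q ^+ i.+1 * c) q m.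
Proof.
move=> h; rewrite exprS -[q * _ * c]mulrA mulrAC -qpoch_shift [_ * c * q ^+ m]mulrAC.
by rewrite -exprD mulfK // off_lattice_1sub.
Qed.

(** Induction on m. The case m = 0 is an induction on k; raising m reflects one more point of the
    first block, which exchanges one inner product for another. The inner products telescope: [up]
    treats a kept point, [down] a reflected one. *)
Lemma block_pair z z' k k' m m' : z != 0 -> z' != 0 ->
  off_lattice (z * z') -> off_lattice (z / z') -> (m <= k)%N -> (m' <= k')%N ->
  \prod_(0 <= i < k) \prod_(0 <= j < k') hl (node m z i * node m' z' j) =
  q ^+ (m * k' + m' * k) * pair_target (z * z') (z / z') k k' m m'.
Proof.
move=> z0 z0' oa or mk mk'.
have up i : \prod_(0 <= j < k') hl (q ^+ i * z * node m' z' j) =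
   (1 - q ^+ (k'.+1 + i) * (z * z')) / (1 - q ^+ (m'.+1 + i) * (z * z'))
   * ((1 - q ^+ i.+1 * (z / z')) / (1 - q ^+ i.+1 / q ^+ m' * (z / z'))).
  have e1 : q ^+ i * z * z' = q ^+ i * (z * z') by ring.
  have e2 : q * (q ^+ i * z / z') = q ^+ i.+1 * (z / z') by rewrite exprS; ring.
  rewrite (prod_hl_node mk' z0'); first last.
  - move=> j _; rewrite e2 -(mulfK (qX_neq0 j) (1 - _)) mulf_neq0 ?invr_neq0 ?qX_neq0 //.
    rewrite mulrBl mul1r divfK ?qX_neq0 // -oppr_eq0 opprB.
    exact: off_lattice_sub.
  - by move=> j; rewrite e1 mulrA -exprD off_lattice_1sub.
  rewrite e1 e2 ![q ^+ _ * (q ^+ i * _)]mulrA -!exprD.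
  by congr (_ * (_ / (1 - _))); ring.
have down i : \prod_(0 <= j < k') hl ((q * (q ^+ i * z))^-1 * node m' z' j) =
   (1 - q ^+ k' / q ^+ i / (z / z')) / (1 - q ^+ m' / q ^+ i / (z / z'))
   * ((1 - (q ^+ i)^-1 / (z * z')) / (1 - (q ^+ i)^-1 / (z * z') / q ^+ m')).
  have e1 : (q * (q ^+ i * z))^-1 * z' = (q ^+ i.+1)^-1 * (z / z')^-1.
    by rewrite exprS; field; rewrite z0 z0' q_neq0 qX_neq0.
  have e2 : q * ((q * (q ^+ i * z))^-1 / z') = (q ^+ i)^-1 * (z * z')^-1.
    by field; rewrite z0 z0' q_neq0 qX_neq0.
  rewrite (prod_hl_node mk' z0'); first last.
  - move=> j _; rewrite e2 -mulrA [_ / q ^+ j]mulrC mulrA -invfM -exprD.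
    rewrite -(mulKf (qX_neq0 (i + j)) (1 - _)) mulf_neq0 ?invr_neq0 ?qX_neq0 //.
    rewrite mulrBr mulr1 mulVKf ?qX_neq0 // -oppr_eq0 opprB.
    by rewrite -[_^-1]mul1r (off_lattice_sub 0 _ (off_lattice_inv oa)).
  - move=> j; rewrite e1 -(mulKf (qX_neq0 i.+1) (1 - _)) mulf_neq0 ?invr_neq0 ?qX_neq0 //.
    rewrite mulrBr mulr1 mulrCA mulVKf ?qX_neq0 // -oppr_eq0 opprB.
    exact/off_lattice_sub/off_lattice_inv.
  rewrite e1 e2; congr ((1 - _) / (1 - _) * _); rewrite [q ^+ _.+1]exprS [q ^+ i.+1]exprS.
    by field; rewrite ?z0 ?z0' ?q_neq0 ?qX_neq0.
  by field; rewrite ?z0 ?z0' ?q_neq0 ?qX_neq0.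
have a0 : z * z' != 0 by rewrite mulf_neq0.
have r0 : z / z' != 0 by rewrite mulf_neq0 ?invr_neq0.
elim: m mk => [_|m IHm mk].
  rewrite (eq_big_nat _ _ (F2 := fun i =>
     (1 - q ^+ (k'.+1 + i) * (z * z')) / (1 - q ^+ (m'.+1 + i) * (z * z'))
   * ((1 - q ^+ i.+1 * (z / z')) / (1 - q ^+ i.+1 / q ^+ m' * (z / z'))))) => [|i _]; last first.
    by rewrite -up.
  move: (z * z') (z / z') oa or a0 r0 => a r oa or a0 r0.
  elim: k => [|k IHk].
    rewrite big_geq // /pair_target !qpoch0 muln0 addn0 expr0 add0n addn0 expr1 invr1 !mul1r.
    have n1 := off_lattice_1sub m' oa; have n2 := off_lattice_sub 0 m' or.
    have n3 := off_lattice_1sub 0 oa; have n4 := off_lattice_sub 0 0 or.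
    rewrite expr0 mul1r in n2; rewrite mul1r in n3; rewrite expr0 mul1r in n4.
    have N1 := off_lattice_qpoch 1 m' oa; rewrite expr1 in N1.
    have N2 := off_lattice_qpoch 1 m' (off_lattice_inv or); rewrite expr1 in N2.
    have E1 : qpoch a q m' = (1 - a) / (1 - q ^+ m' * a) * qpoch (q * a) q m'.
      by rewrite mulrAC -qpoch_shift [a * _]mulrC mulfK.
    have E2 : qpoch r^-1 q m' = (1 - r^-1) / (1 - q ^+ m' / r) * qpoch (q / r) q m'.
      rewrite mulrAC -qpoch_shift [r^-1 * _]mulrC mulfK //.
      exact/off_lattice_1sub/off_lattice_inv.
    rewrite E1 E2; move: n1 n2 n3 n4 N1 N2.
    move: (qpoch _ _ _) (qpoch _ _ _) (q ^+ m') => A B M n1 n2 n3 n4 N1 N2; field.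
    by rewrite ?n1 ?n2 ?n3 ?n4 ?N1 ?N2 ?r0.
  rewrite big_nat_recr //= IHk /pair_target 2!qpochS.
  have n1 := off_lattice_1sub (1 + k) oa.
  have n2 := off_lattice_1sub (1 + k + m') oa.
  have n3 := off_lattice_sub (1 + k) m' or.
  have n4 := off_lattice_sub (1 + k) 0 or.
  have E1 : qpoch ((q ^+ k.+1)^-1 / r) q m' = (1 - q ^- k.+1 / r) /
      (1 - q ^- k.+1 / r * q ^+ m') * qpoch (q ^- k / r) q m'.
    rewrite mulrAC; have -> : q ^- k / r = q * (q ^- k.+1 / r).
      by rewrite exprS; field; rewrite q_neq0 r0 qX_neq0.
    rewrite -qpoch_shift mulfK //.
    rewrite (_ : _ - _ = (q ^+ (1 + k) * r - q ^+ m') / (q ^+ (1 + k) * r)).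
      by rewrite mulf_neq0 // invr_neq0 // mulf_neq0 // qX_neq0.
    by move: (qX_neq0 k.+1) => h; rewrite add1n; field; rewrite h r0.
  have E2 := qpoch_down (1 + k) m' oa; rewrite -addnS in E2.
  have N1 := off_lattice_qpoch 1 k oa; rewrite expr1 in N1.
  have N2 := off_lattice_qpoch (1 + k.+1) m' oa.
  have N3 := off_lattice_qpoch 1 m' (off_lattice_inv or); rewrite expr1 in N3.
  rewrite E1 E2 add0n mul0n mulnS !qpoch0.
  move: N1 N2 N3 n1 n2 n3 n4.
  move: (qpoch (q * a) q k) (qpoch (q ^+ (k' + 1) * a) q k) (qpoch (q ^+ (1 + k.+1) * a) q m').
  move: (qpoch (q / r) q m') (qpoch (q ^- k / r) q m') (qpoch a q m').
  rewrite !exprD !exprS !expr0 !mulr1 !mul1r.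
  move: (qX_neq0 k) (qX_neq0 m').
  move: (q ^+ k) (q ^+ m') (q ^+ k') (q ^+ (m' * k)) => K M K' U.
  move=> h1 h2 A B C D E G h3 h4 h5 h6 h7 h8 _.
  have h9 : M - q * K * r != 0 by rewrite -opprB oppr_eq0.
  have h10 : 1 - q * a * K != 0 by rewrite mulrAC.
  have h11 : 1 - q * M * K * a != 0 by rewrite [q * M * K]mulrAC.
  have h12 : 1 - a != 0 by have := off_lattice_1sub 0 oa; rewrite mul1r.
  have h13 : r - 1 != 0 by have := off_lattice_sub 0 0 or; rewrite mul1r.
  by field; rewrite ?h1 ?h2 ?h3 ?h4 ?h5 ?h6 ?h7 ?h8 ?h9 ?h10 ?h11 ?h12 ?h13 ?r0 ?q_neq0 ?oner_neq0.
have {}IHm := IHm (ltnW mk).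
set H := fun u => \prod_(0 <= j < k') hl (u * node m' z' j).
(* Passing from m to m + 1 changes only the factor of index m. *)
have flipm : (\prod_(0 <= i < k) H (node m.+1 z i)) * H (q ^+ m * z) =
     (\prod_(0 <= i < k) H (node m z i)) * H (q * (q ^+ m * z))^-1.
  rewrite !big_mkord (bigD1 (Ordinal mk)) // [in RHS](bigD1 (Ordinal mk)) //=.
  have -> : node m.+1 z m = (q * (q ^+ m * z))^-1 by rewrite /node ltnSn.
  have -> : node m z m = q ^+ m * z by rewrite /node ltnn.
  rewrite mulrAC [RHS]mulrAC [X in X * _ = _]mulrC; congr (_ * _).
  apply: eq_bigr => i; rewrite -val_eqE /= => im; rewrite /node ltnS leq_eqVlt.
  by rewrite (negbTE im).
rewrite /H up down -!/(H _) in flipm.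
have nz : (1 - q ^+ (k'.+1 + m) * (z * z')) / (1 - q ^+ (m'.+1 + m) * (z * z')) *
          ((1 - q ^+ m.+1 * (z / z')) / (1 - q ^+ m.+1 / q ^+ m' * (z / z'))) != 0.
  rewrite !mulf_neq0 ?invr_neq0 ?off_lattice_1sub //.
  rewrite (_ : _ - _ = - (q ^+ m.+1 * (z / z') - q ^+ m') / q ^+ m').
    by rewrite mulf_neq0 ?invr_neq0 ?qX_neq0 // oppr_eq0 off_lattice_sub.
  by field; rewrite z0' qX_neq0.
apply: (mulIf nz); rewrite [LHS]flipm [X in X * _ = _]IHm /pair_target.
move: (z * z') (z / z') oa or a0 r0 => a r oa or a0 r0.
rewrite 4!qpochS mulSn.
have N1 := off_lattice_qpoch 1 m or; rewrite expr1 in N1.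
have N2 := off_lattice_qpoch (1 + k') m oa.
have N3 := off_lattice_qpoch 1 k oa; rewrite expr1 in N3.
have N4 := off_lattice_qpoch (1 + k) m' oa.
have N5 := off_lattice_qpoch 1 m' (off_lattice_inv or); rewrite expr1 in N5.
have n1 := off_lattice_1sub (1 + m) or.
have n2 := off_lattice_1sub (1 + k' + m) oa.
have n3 := off_lattice_sub m m' or.
have n4 := off_lattice_1sub (m + m') oa.
have n5 := off_lattice_1sub (1 + m' + m) oa.
have n6 := off_lattice_sub (1 + m) m' or.
have n7 : 1 - a != 0 by have := off_lattice_1sub 0 oa; rewrite mul1r.
have n8 : r - 1 != 0 by have := off_lattice_sub 0 0 or; rewrite mul1r.
move: N1 N2 N3 N4 N5 n1 n2 n3 n4 n5 n6.
move: (qpoch (q * a) q k) (qpoch (q ^+ (k' + 1) * a) q k) (qpoch (q ^+ (1 + k) * a) q m').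
move: (qpoch (q / r) q m') (qpoch (q ^- k / r) q m') (qpoch a q m').
move: (qpoch a q m) (qpoch (q ^+ (1 + k') * a) q m) (qpoch (q * r) q m) (qpoch (q ^- k' * r) q m).
rewrite !exprD !exprS !expr0 !mulr1 ?mul1r.
move: (qX_neq0 k') (qX_neq0 m') (qX_neq0 m).
move: (q ^+ m') (q ^+ k') (q ^+ (m' * k)) (q ^+ (m * k')) (q ^+ m) => M' K' U V M.
move=> h1 h2 h3 A B C D E G H' I J L N1 N2 N3 N4 N5 n1 n2 n3 n4 n5 n6.
have g1 : M' - q * M * r != 0 by rewrite -opprB oppr_eq0.
have g2 : 1 - q * K' * a * M != 0 by rewrite [q * K' * a * M]mulrAC.
have g3 : 1 - q * r * M != 0 by rewrite mulrAC.
have g4 : M * a * M' - 1 != 0 by rewrite mulrAC -opprB oppr_eq0.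
by field; rewrite ?h1 ?h2 ?h3 ?N1 ?N2 ?N3 ?N4 ?N5 ?n1 ?n2 ?n3 ?n4 ?n5 ?n6 ?n7 ?n8
   ?g1 ?g2 ?g3 ?g4 ?a0 ?r0 ?q_neq0 ?oner_neq0.
Qed.

(** The part of the prefactor and of c_m that belongs to a single block, with a the square of its
    base. *)
Definition diag_target a k m : F :=
  qpoch (q * a) (q ^+ 2) k / qpoch (q * a) q k * ((1 - q ^+ (m + m) * a) / (1 - a))
  * (qpoch (q ^- k) q m / qpoch q q m) * (qpoch a q m / qpoch (q ^+ (1 + k) * a) q m).

Lemma block_diag z k m : z != 0 -> off_lattice (z * z) -> (m <= k)%N ->
  \prod_(0 <= i < k) \prod_(0 <= j < i) hl (node m z i * node m z j) =
  (-1) ^+ m * q ^+ (k * m) * diag_target (z * z) k m.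
Proof.
move=> z0 oa.
have a0 : z * z != 0 by rewrite mulf_neq0.
have qq i : 1 - q ^+ i.+1 != 0 by rewrite subr_eq0 eq_sym q_expn.
have n7 : 1 - z * z != 0 by have := off_lattice_1sub 0 oa; rewrite mul1r.
elim: k m => [|k IHk] m mk.
  move: mk; rewrite leqn0 => /eqP ->; rewrite big_geq // /diag_target !qpoch0.
  by rewrite muln0 addn0 !expr0 !(mul1r, divr1, mulr1) divff // invr1 mul1r.
(* The added point, of index k, is kept if m <= k. Otherwise m = k + 1, all points are reflected,
   and the earlier ones form the case (k, k). *)
move: mk; rewrite leq_eqVlt ltnS => /orP[/eqP ->|mk]; last first.
  rewrite big_nat_recr //= IHk //.
  have -> : node m z k = q ^+ k * z by rewrite /node ltnNge mk.
  have e1 : q ^+ k * z / z = q ^+ k by rewrite mulfK.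
  have nqm j : (j <= k)%N -> q ^+ k.+1 - q ^+ j != 0.
    move=> jk; rewrite -(subnK (leqW jk)) exprD -[X in _ - X]mul1r -mulrBl.
    by rewrite mulf_neq0 ?qX_neq0 // subr_eq0 q_expn // subn_gt0 ltnS.
  rewrite (@prod_hl_node (q ^+ k * z) z m k) //; first last.
  - move=> j jm; rewrite e1 -exprS.
    rewrite (_ : _ - _ = - (q ^+ k.+1 - q ^+ j) / q ^+ j); last by field; rewrite qX_neq0.
    by rewrite mulf_neq0 ?invr_neq0 ?qX_neq0 // oppr_eq0 nqm // (leq_trans jm).
  - by move=> j; rewrite -!mulrA mulrA -exprD off_lattice_1sub.
  have -> : q ^+ k * z * z = q ^+ k * (z * z) by rewrite mulrA.
  rewrite e1 /diag_target; move: (z * z) oa a0 n7 => a oa a0 n7.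
  have E1 : qpoch (q ^- k.+1) q m = (1 - q ^- k.+1) / (1 - q ^- k.+1 * q ^+ m) * qpoch (q ^- k) q m.
    rewrite mulrAC; have -> : q ^- k = q * q ^- k.+1 by rewrite exprS invfM mulVKf.
    rewrite -qpoch_shift mulfK //.
    rewrite (_ : _ - _ = (q ^+ k.+1 - q ^+ m) / q ^+ k.+1); last by field; rewrite qX_neq0.
    by rewrite mulf_neq0 ?invr_neq0 ?qX_neq0 // nqm.
  have n1 := nqm m mk; have n2 := qq k; have n3 := qq m.
  have n4 := off_lattice_1sub (1 + k) oa; have n5 := off_lattice_1sub (1 + k + m) oa.
  have N1 := off_lattice_qpoch 1 k oa; rewrite expr1 in N1.
  have N2 := off_lattice_qpoch (1 + k).+1 m oa.
  have N3 := qpochq_neq0 q_expn m.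
  rewrite E1 (qpoch_down (1 + k) m oa) 2!qpochS addnS mulSn -exprM mul2n -addnn.
  move: n1 n2 n3 n4 n5 N1 N2 N3.
  move: (qpoch (q * a) (q ^+ 2) k) (qpoch (q * a) q k) (qpoch (q ^- k) q m).
  move: (qpoch q q m) (qpoch a q m) (qpoch (q ^+ (1 + k).+1 * a) q m) => A B C D E G.
  rewrite !exprD !exprS !expr0 !mulr1 ?mul1r.
  move: (qX_neq0 k) (qX_neq0 m); move: (q ^+ (k * m)) (q ^+ k) (q ^+ m) ((-1) ^+ m) => U K M S.
  move=> h1 h2 n1 n2 n3 n4 n5 N1 N2 N3.
  have g1 : M - q * K != 0 by rewrite -opprB oppr_eq0.
  have g2 : 1 - q * a * K != 0 by rewrite mulrAC.
  have g3 : 1 - q * M * (K * a) != 0 by rewrite [_ * (K * a)]mulrA [q * M * K]mulrAC.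
  by field; rewrite ?h1 ?h2 ?n1 ?n2 ?n3 ?n4 ?n5 ?n7 ?N1 ?N2 ?N3 ?g1 ?g2 ?g3 ?q_neq0.
rewrite big_nat_recr //=.
rewrite (eq_big_nat _ _ (F2 := fun i =>
  \prod_(0 <= j < i) hl (node k z i * node k z j))) => [|i /andP[_ ik]]; last first.
  apply: eq_big_nat => j /andP[_ ji].
  by rewrite /node ik (ltn_trans ji ik) !ltnS ltnW // ltnW // (ltn_trans ji ik).
rewrite IHk //.
have -> : node k.+1 z k = (q * (q ^+ k * z))^-1 by rewrite /node ltnSn.
set u := (q ^+ k.+1 * (z * z))^-1.
have e2 : q * u = (q ^+ k * (z * z))^-1.
  by rewrite /u exprS; field; rewrite z0 q_neq0 qX_neq0.
have e3 j : q * u / q ^+ j = (q ^+ (k + j) * (z * z))^-1.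
  by rewrite e2 exprD; field; rewrite z0 !qX_neq0.
rewrite (eq_big_nat _ _ (F2 := fun j => hl (u / (q * q ^+ j)))) => [|j /andP[_ jk]]; last first.
  rewrite /node ltnS (ltnW jk) /u exprS; congr hl_factor.
  by field; rewrite z0 q_neq0 !qX_neq0.
rewrite prod_hl_down => [|j _]; last first.
  rewrite e3 (_ : _ - _ = - (1 - q ^+ (k + j) * (z * z)) / (q ^+ (k + j) * (z * z))).
    by rewrite mulf_neq0 ?invr_neq0 ?mulf_neq0 ?qX_neq0 // oppr_eq0 off_lattice_1sub.
  by field; rewrite z0 qX_neq0.
rewrite e3 e2 /diag_target.
move: (z * z) oa a0 n7 => a oa a0 n7.
have E1 : qpoch (q ^- k.+1) q k.+1 = (1 - q ^- k.+1) * qpoch (q ^- k) q k.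
  by rewrite qpochSl exprS invfM mulrAC mulVf // mul1r.
have n2 := qq k; have n3 := off_lattice_1sub (k + k) oa.
have n4 := off_lattice_1sub (1 + k) oa; have n5 := off_lattice_1sub (1 + k + k) oa.
have n6 := off_lattice_1sub (1 + (1 + k + k)) oa.
have N1 := off_lattice_qpoch 1 k oa; rewrite expr1 in N1.
have N2 := off_lattice_qpoch (1 + k).+1 k oa.
have N3 := qpochq_neq0 q_expn k.
rewrite E1 (qpoch_down (1 + k) k oa) 5!qpochS addnS mulSn mulnS -exprM mul2n -addnn.
move: n2 n3 n4 n5 n6 N1 N2 N3.
move: (qpoch (q * a) (q ^+ 2) k) (qpoch (q * a) q k) (qpoch (q ^- k) q k).
move: (qpoch q q k) (qpoch a q k) (qpoch (q ^+ (1 + k).+1 * a) q k) => A B C D E G.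
rewrite !exprD !exprS !expr0 !mulr1 ?mul1r.
move: (qX_neq0 k); move: (q ^+ (k * k)) (q ^+ k) ((-1) ^+ k) => U K S.
move=> h1 n2 n3 n4 n5 n6 N1 N2 N3.
have g1 : 1 - q * (q * K) * a * K != 0 by rewrite mulrAC -[q * (q * K) * K]mulrA.
have g2 : 1 - q * a * K != 0 by rewrite mulrAC.
have g3 : K * K * a - 1 != 0 by rewrite -opprB oppr_eq0.
by field; rewrite ?h1 ?n2 ?n3 ?n4 ?n5 ?n7 ?N1 ?N2 ?N3 ?g1 ?g2 ?g3 ?q_neq0 ?a0.
Qed.

End Blocks.

(** * Block indices and initial segments *)

Section BlockIndices.
Variables (s : nat) (k : 'I_s -> nat).

(* Index (l, j) stands for the variable q^j z_l of block l. *)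
Local Notation bidx := ('I_s * 'I_(weight k))%type.
Definition blocks : {set bidx} := [set x : bidx | (x.2 < k x.1)%N].
(* The order is reversed inside a block, so that the inner index of a product
   over the pairs of a block ranges over j < i. *)
Definition blt (x y : bidx) : bool :=
  (x.1 < y.1)%N || ((x.1 == y.1) && (y.2 < x.2)%N).
Definition initial (m : 'I_s -> nat) : {set bidx} := [set x : bidx | (x.2 < m x.1)%N].

Lemma leq_weight l : (k l <= weight k)%N.
Proof. by rewrite /weight (bigD1 l) //= leq_addr. Qed.

Lemma big_blocks (R : Type) (idx : R) (op : Monoid.com_law idx)
    (f : 'I_s -> nat -> R) :
  \big[op/idx]_(x in blocks) f x.1 x.2 =
  \big[op/idx]_l \big[op/idx]_(0 <= j < k l) f l j.
Proof.
under [RHS]eq_bigr => l _.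
  rewrite big_mkord (big_ord_widen (weight k) (f l) (leq_weight l)).
  over.
by rewrite pair_big_dep; apply: eq_big => // x; rewrite inE.
Qed.

Lemma card_blocks : #|blocks| = weight k.
Proof.
rewrite -sum1_card (big_blocks _ (fun _ _ => 1%N)).
by apply: eq_bigr => l _; rewrite sum_nat_const_nat muln1 subn0.
Qed.

Lemma blt_irr : irreflexive blt.
Proof. by move=> x; rewrite /blt !ltnn andbF. Qed.

Lemma blt_tot x y : x != y -> blt x y = ~~ blt y x.
Proof.
case: x y => [l i] [l' j] h; rewrite /blt /=.
have [ll|ll|ll] := ltngtP l l'.
- by rewrite -!val_eqE /= ?(ltn_eqF ll) ?(gtn_eqF ll).
- by rewrite -!val_eqE /= ?(ltn_eqF ll) ?(gtn_eqF ll).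
rewrite -!val_eqE /= ll eqxx /=.
rewrite -leqNgt [RHS]leq_eqVlt; case: eqP => [e|//].
by case/eqP: h; congr pair; apply: val_inj; [exact: ll | exact: (esym e)].
Qed.

Lemma pair_prod_blocks (F : fieldType) (H : 'I_s -> nat -> 'I_s -> nat -> F) :
  pair_prod blt (fun x y => H x.1 x.2 y.1 y.2) blocks =
  (\prod_(l < s) \prod_(0 <= i < k l) \prod_(0 <= j < i) H l i l j) *
  (\prod_(l < s) \prod_(l' < s | (l < l')%N)
     \prod_(0 <= i < k l) \prod_(0 <= j < k l') H l i l' j).
Proof.
rewrite /pair_prod.
transitivity (\prod_(l < s) \prod_(0 <= i < k l)
  ((\prod_(0 <= j < i) H l i l j) *
   (\prod_(l' < s | (l < l')%N) \prod_(0 <= j < k l') H l i l' j))).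
  rewrite -[RHS]big_blocks; apply: eq_bigr => -[l i] /=; rewrite inE /= => ik.
  (* The default value 1 absorbs the order condition, so that the product may run over full
     blocks. *)
  pose f (l' : 'I_s) j := if (l < l')%N || ((l == l') && (j < i)%N) then H l i l' j else 1.
  rewrite big_mkcondr (eq_bigr (fun y : bidx => f y.1 y.2)) // big_blocks (bigD1 l) //=.
  congr (_ * _).
    rewrite !big_mkord (big_ord_widen _ _ (ltnW ik)) [RHS]big_mkcond.
    by apply: eq_bigr => j _; rewrite /f ltnn eqxx /=.
  rewrite [RHS](eq_bigl (fun l' => (l' != l) && (l < l')%N)); last first.
    by move=> l'; case: (ltngtP l l') => //;
      [rewrite -val_eqE /= => /gtn_eqF -> | rewrite andbF | rewrite andbF].
  rewrite [RHS]big_mkcondr; apply: eq_bigr => l' ll; case: ifP => lt_l.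
    by apply: eq_bigr => j _; rewrite /f lt_l.
  by rewrite big1 // => j _; rewrite /f lt_l eq_sym (negbTE ll).
rewrite -big_split /=; apply: eq_bigr => l _; rewrite big_split /=; congr (_ * _).
by rewrite exchange_big.
Qed.

Lemma card_ord_lt M c : (c <= M)%N -> #|[set j : 'I_M | (j < c)%N]| = c.
Proof.
move=> cM; rewrite -sum1_card (eq_bigl (fun j : 'I_M => (j < c)%N)); last first.
  by move=> j; rewrite inE.
by rewrite -(big_ord_widen M (fun=> 1%N) cM) sum1_card card_ord.
Qed.

(** If j belongs to A, then A has at least the j + 1 elements up to j; if not, A lies strictly below
    j and has at most j elements. *)
Lemma down_closed_card M (A : {set 'I_M}) :
  (forall i j : 'I_M, (i <= j)%N -> j \in A -> i \in A) ->
  forall j, (j \in A) = (j < #|A|)%N.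
Proof.
move=> h j; apply/idP/idP => [jA|].
  rewrite -(card_ord_lt (ltn_ord j)); apply/subset_leq_card/subsetP => i.
  by rewrite inE ltnS => ij; apply: h jA.
apply: contraLR => jA; rewrite -leqNgt -(card_ord_lt (ltnW (ltn_ord j))).
apply/subset_leq_card/subsetP => i iA; rewrite inE ltnNge.
by apply: contra jA => ji; apply: h iA.
Qed.

(** The default value of [inord] does not arise for subsets of [blocks], which have at most k_l
    points in block l. *)
Definition profile (S : {set bidx}) : {dffun forall l : 'I_s, 'I_(k l).+1} :=
  [ffun l => inord #|[set j | (l, j) \in S]|].

Lemma initialK (m : {dffun forall l : 'I_s, 'I_(k l).+1}) :
  profile (initial (fun l => m l)) = m.
Proof.
apply/ffunP => l; rewrite ffunE; apply: val_inj; rewrite /= inordK.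
  rewrite -[RHS](@card_ord_lt (weight k)); last first.
    by rewrite (leq_trans _ (leq_weight l)) // -ltnS.
  by apply: eq_card => j; rewrite !inE.
rewrite ltnS -[X in (_ <= X)%N](card_ord_lt (leq_weight l)).
apply/subset_leq_card/subsetP => j; rewrite !inE /= => h.
by rewrite (leq_trans h) // -ltnS.
Qed.

Lemma profileK (S : {set bidx}) : S \subset blocks ->
  (forall l (i j : 'I_(weight k)), j = i.+1 :> nat -> (l, j) \in S -> (l, i) \in S) ->
  initial (fun l => profile S l) = S.
Proof.
move=> /subsetP sS h; apply/setP => -[l j]; rewrite inE /= ffunE inordK; last first.
  rewrite ltnS -[X in (_ <= X)%N](card_ord_lt (leq_weight l)).
  by apply/subset_leq_card/subsetP => i; rewrite !inE => /sS; rewrite inE.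
rewrite -down_closed_card ?inE // => i i'; rewrite !inE => ii iS.
(* Closure under predecessors is iterated along the distance of the two indices, bounded by d. *)
have [d] : exists d, (i' <= d + i)%N by exists i'; apply: leq_addr.
elim: d i' ii iS => [|d IH] i' ii iS hd.
  by have <- : i' = i by apply/val_inj/eqP; rewrite eqn_leq ii hd.
move: ii; rewrite leq_eqVlt => /orP[/eqP/val_inj -> //|ii].
have i1 : (i'.-1 < weight k)%N by rewrite (leq_ltn_trans (leq_pred _)).
apply: (IH (Ordinal i1)) => /=.
- by rewrite -ltnS (ltn_predK ii).
- by apply: h iS; rewrite /= (ltn_predK ii).
by rewrite -ltnS (ltn_predK ii) -addSn.
Qed.

End BlockIndices.

(** * The general identity under nondegeneracy conditions *)

Section Reduction.
Variables (F : fieldType) (q : F) (s : nat) (k : 'I_s -> nat) (n : nat).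
Variables (w : F) (z : 'I_s -> F).
Hypothesis q_neq0 : q != 0.
Hypothesis q_expn : forall i, (0 < i)%N -> q ^+ i != 1.
Hypothesis q_expn1 : forall i : nat, q ^+ i + 1 != 0.
Hypothesis z_neq0 : forall l, z l != 0.
Hypothesis w_neq0 : w != 0.
Hypothesis off_zz : forall l l', off_lattice q (z l * z l').
Hypothesis off_z_z : forall l l', l != l' -> off_lattice q (z l / z l').
Hypothesis off_ww : off_lattice q (w ^+ 2).
Hypothesis off_wz : forall l, off_lattice q (w * z l).
Hypothesis off_w_z : forall l, off_lattice q (w / z l).

Local Notation bidx := ('I_s * 'I_(weight k))%type.

Definition bvar (x : bidx) : F := q ^+ x.2 * z x.1.

Lemma flip_bvar m x : flip q bvar (initial k m) x = node q (m x.1) (z x.1) x.2.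
Proof. by rewrite /flip inE. Qed.

(** When q^(i+1) z_l is reflected and q^i z_l is kept, the product of the two resulting points is
    q^(-2), the zero of g. *)
Lemma flip_term_gap (S : {set bidx}) l (i j : 'I_(weight k)) : S \subset blocks k ->
  j = i.+1 :> nat -> (l, j) \in S -> (l, i) \notin S ->
  flip_term q (@blt s k) n w bvar (blocks k) S = 0.
Proof.
move=> /subsetP sS ij jS iS; rewrite /flip_term /pair_prod.
have jJ := sS _ jS.
have iJ : (l, i) \in blocks k.
  by move: jJ; rewrite !inE /= ij; apply: leq_trans.
rewrite (bigD1 (l, j)) //= (bigD1 (l, i)) /=; last first.
  by rewrite iJ /blt /= eqxx ij leqnn orbT.
rewrite /flip jS (negbTE iS) /hl_factor /bvar /= ij.
have -> : 1 - q ^+ 2 * ((q * (q ^+ i.+1 * z l))^-1 * (q ^+ i * z l)) = 0.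
  by rewrite [q ^+ i.+1]exprS; field; rewrite z_neq0 q_neq0 qX_neq0.
by rewrite !mul0r.
Qed.

(** A subset is either recovered from its profile, or it has a gap in some block and contributes
    zero. *)
Lemma flip_sum_blocks :
  flip_sum q (@blt s k) n w bvar (blocks k) =
  \sum_(m : {dffun forall l : 'I_s, 'I_(k l).+1})
    flip_term q (@blt s k) n w bvar (blocks k) (initial k (fun l => m l)).
Proof.
rewrite /flip_sum (bigID (fun S : {set bidx} => initial k (fun l => profile S l) == S)) /=.
rewrite [X in _ + X]big1 ?addr0 => [|S /andP[sS nS]].
  rewrite (reindex_onto (fun m : {dffun forall l : 'I_s, 'I_(k l).+1} =>
     initial k (fun l => m l)) (@profile s k)); last by move=> S /andP[_ /eqP].
  apply: eq_bigl => m; rewrite !initialK !eqxx !andbT.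
  by apply/subsetP => x; rewrite !inE => h; rewrite (leq_trans h) // -ltnS.
have [e|] := boolP [forall l, forall i : 'I_(weight k), forall j : 'I_(weight k),
   (j == i.+1 :> nat) && ((l, j) \in S) ==> ((l, i) \in S)].
  case/negP: nS; apply/eqP/profileK => // l i j ij jS.
  by have /forallP/(_ l)/forallP/(_ i)/forallP/(_ j) := e; rewrite ij eqxx jS.
rewrite negb_forall => /existsP[l]; rewrite negb_forall => /existsP[i].
rewrite negb_forall => /existsP[j]; rewrite negb_imply => /andP[/andP[/eqP ij jS] iS].
exact: flip_term_gap ij jS iS.
Qed.

Lemma bvar_generic : generic_params q w bvar (blocks k).
Proof.
split=> //.
- by move=> x _; rewrite mulf_neq0 ?qX_neq0.
- move=> [l i] [l' j] _ _; rewrite /bvar /=; have [->|ll] := eqVneq l l'.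
    move=> h; rewrite (inj_eq (mulIf (z_neq0 l'))); move: h.
    wlog ij : i j / (i <= j)%N => [H h|].
      have [ij|ij] := leqP i j; first exact: H.
      by rewrite eq_sym H // 1?eq_sym // ltnW.
    move=> h; have lij : (i < j)%N.
      rewrite ltn_neqAle ij andbT; apply: contra h => /eqP e; apply/eqP.
      by congr pair; apply: val_inj.
    rewrite -(subnK ij) exprD eq_sym -subr_eq0 -[X in _ - X]mul1r -mulrBl.
    by rewrite mulf_neq0 ?qX_neq0 // subr_eq0 q_expn // subn_gt0.
  move=> _; have := off_lattice_neq q_neq0 i j (off_z_z ll).
  by apply: contra => /eqP e; rewrite mulrA e mulfK.
- move=> [l i] [l' j] _ _; rewrite /bvar /=.
  have := off_lattice_neq q_neq0 (i + j).+1 0 (off_zz l l').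
  by rewrite exprS exprD expr0 (_ : _ * (_ * _) = q * (q ^+ i * z l) * (q ^+ j * z l')) //; ring.
- by move=> i [l j] _; rewrite /bvar /= mulrCA; apply: (off_lattice_mul q_neq0).
move=> i [l j] _; rewrite /bvar /= mulrA.
apply: contra (off_w_z l (i + j%:Z)) => /eqP ->.
by rewrite mulfK // expfzDr.
Qed.

Lemma prod_rev_qpoch c m :
  \prod_(0 <= j < m) (1 - c / (q * q ^+ j)) = qpoch (q ^- m * c) q m.
Proof.
elim: m => [|m IH]; first by rewrite big_geq // qpoch0.
rewrite big_nat_recr //= IH qpochSl mulrC exprS [c / _]mulrC; congr (_ * qpoch _ _ _).
by field; rewrite q_neq0 qX_neq0.
Qed.

Lemma wp_node_blocks i :
  wp_node q w bvar (blocks k) i =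
  \prod_(l < s) (qpoch (w * z l * q ^+ i) q (k l)
                 * qpoch (q ^- k l * (w / z l) * q ^+ i) q (k l)).
Proof.
rewrite /wp_node (big_blocks k _ (fun l j => (1 - q ^+ i * w * (q ^+ j * z l)) *
   (1 - q ^+ i * w / (q * (q ^+ j * z l))))).
apply: eq_bigr => l _; rewrite big_split /=; congr (_ * _).
  by apply: eq_bigr => j _; congr (1 - _); ring.
rewrite -mulrA -prod_rev_qpoch; apply: eq_bigr => j _; congr (1 - _).
by field; rewrite ?z_neq0 ?q_neq0 ?qX_neq0.
Qed.

(** Both sides are (c; q)_(i+m). *)
Lemma qpoch_swap c i m :
  qpoch c q i * qpoch (c * q ^+ i) q m = qpoch c q m * qpoch (q ^+ m * c) q i.
Proof.
have D a b : qpoch c q a * qpoch (c * q ^+ a) q b = qpoch c q (a + b).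
  elim: b => [|b IH]; first by rewrite qpoch0 mulr1 addn0.
  by rewrite qpochS mulrA IH addnS qpochS -mulrA -exprD.
by rewrite D [q ^+ m * c]mulrC D addnC.
Qed.

Lemma off_lattice_v l m : off_lattice q (q ^- m * (w / z l)).
Proof.
move=> i; apply: contra (off_w_z l (m%:Z + i)) => /eqP e.
by rewrite expfzDr // -e -[q ^ m%:Z]/(q ^+ m) mulVKf ?qX_neq0.
Qed.

(** The quotient of [wp_sum] over the blocks by the left-hand side of the theorem. It is also the
    product of [side] over the blocks when no point is reflected. *)
Definition side_denom : F := \prod_(l < s)
  (qpoch (w * z l) q (k l) * qpoch (q ^- k l * (w / z l) * q ^+ n) q (k l)).

Lemma side_denom_neq0 : side_denom != 0.
Proof.
apply/prodf_neq0 => l _; rewrite mulf_neq0 //; first exact: off_lattice_qpoch0.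
by rewrite mulrC off_lattice_qpoch //; apply: off_lattice_v.
Qed.

(** By [qpoch_swap], used with i and with n, factorials whose length is i or n become factorials of
    length k_l. *)
Lemma lhs_coef i :
  (\prod_(l < s) (qpoch (q ^- k l * w / z l) q n / qpoch (w / z l) q n)) *
  \prod_(l < s) ((qpoch (w / z l) q i * qpoch (q ^+ k l * w * z l) q i) /
     (qpoch (w * z l) q i * qpoch (q ^- k l * w / z l) q i)) =
  wp_node q w bvar (blocks k) i / side_denom.
Proof.
rewrite wp_node_blocks /side_denom -big_split /= -prodf_div; apply: eq_bigr => l _.
have h := qpoch_swap (w * z l) i (k l).
have h1 := qpoch_swap (q ^- k l * (w / z l)) i (k l).
have h2 := qpoch_swap (q ^- k l * (w / z l)) n (k l).
rewrite !mulVKf ?qX_neq0 // in h1 h2.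
rewrite -![q ^+ k l * w * _]mulrA -![q ^- k l * w * _]mulrA.
have N1 := off_lattice_qpoch0 q_neq0 (k l) (off_wz l).
have N2 := off_lattice_qpoch0 q_neq0 i (off_wz l).
have N3 := off_lattice_qpoch0 q_neq0 (k l) (off_lattice_v l (k l)).
have N4 := off_lattice_qpoch0 q_neq0 i (off_lattice_v l (k l)).
have N5 := off_lattice_qpoch q_neq0 n (k l) (off_lattice_v l (k l)).
rewrite [q ^+ n * _]mulrC in N5.
have N6 := off_lattice_qpoch0 q_neq0 n (off_w_z l).
have e0 := canRL (mulKf N1) (esym h).
have e1 := canRL (mulKf N3) (esym h1).
have e2 := canRL (mulKf N3) (esym h2).
rewrite e2 in N6; rewrite e0 e1 e2; move: N1 N2 N3 N4 N5 N6.
move: (qpoch (w * z l * q ^+ i) q (k l)) (qpoch (q ^- k l * (w / z l) * q ^+ i) q (k l)).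
move: (qpoch (q ^- k l * (w / z l) * q ^+ n) q (k l)) (qpoch (q ^- k l * (w / z l)) q n).
move: (qpoch (q ^- k l * (w / z l)) q (k l)) (qpoch (q ^- k l * (w / z l)) q i).
move: (qpoch (w * z l) q i) (qpoch (w * z l) q (k l)) => A B C D E G H I N1 N2 N3 N4 N5 N6.
have /and3P[_ N7 N8] : [&& C^-1 != 0, G != 0 & E != 0].
  by move: N6; rewrite !mulf_eq0 !negb_or.
by field; rewrite ?N1 ?N2 ?N3 ?N4 ?N5 ?N7 ?N8.
Qed.

Lemma prod_interleave (u v : 'I_s -> F) (f : F -> F) :
  \prod_(a <- interleave u v) f a = \prod_(l < s) (f (u l) * f (v l)).
Proof.
rewrite /interleave big_flatten big_map big_enum /=.
by apply: eq_bigr => l _; rewrite !big_cons big_nil mulr1.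
Qed.

Lemma qpoch_qN_eq0 i : (n < i)%N -> qpoch (q ^- n) q i = 0.
Proof.
move=> ni; rewrite /qpoch big_mkord (bigD1 (Ordinal ni)) //=.
by rewrite mulVf ?qX_neq0 // subrr mul0r.
Qed.

Lemma fsbig_nat_ord (f : nat -> F) N : (forall i, (N <= i)%N -> f i = 0) ->
  (\sum_(i \in [set: nat]%classic) f i = \sum_(i < N) f i).
Proof.
move=> h; rewrite fsbig_ord; apply/esym/fsbig_widen => // i [_ /=].
by move=> /negP; rewrite -leqNgt => /h.
Qed.

Lemma lhs_wp_sum y :
  qpoch (q * w ^+ 2) (q ^+ 2) n / qpoch (w ^+ 2) q n
  * (\prod_(l < s) (qpoch (q ^- k l * w / z l) q n / qpoch (w / z l) q n))
  * qhyp
      ([:: w ^+ 2 / q; q ^- n]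
         ++ interleave (fun l => w / z l) (fun l => q ^+ k l * w * z l))
      ([:: q ^+ n * w ^+ 2]
         ++ interleave (fun l => w * z l) (fun l => q ^- k l * w / z l)) q y
  = wp_sum q n w y (wp_node q w bvar (blocks k)) / side_denom.
Proof.
(* The parameter q^(-n) annihilates all terms beyond i = n. *)
rewrite /qhyp (@fsbig_nat_ord _ n.+1); last first.
  move=> i ni; rewrite big_cat !big_cons /= qpoch_qN_eq0 //.
  by rewrite !(mul0r, mulr0).
rewrite /wp_sum -/(wp_pref q n w) -[LHS]mulrA -[RHS]mulrA; congr (_ * _).
rewrite mulr_sumr mulr_suml; apply: eq_bigr => i _.
rewrite -[RHS]mulrA -[_ / side_denom]lhs_coef.
rewrite !big_cat !big_cons !big_nil ?mulr1 /= !prod_interleave /wp_coef.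
rewrite !prodf_div !invfM !mulr1 ?invr1 ?mulr1.
move: (\prod_(i < s) _) (\prod_(i < s) _)^-1 (\prod_(i < s) _) (\prod_(i < s) _)^-1.
move: (_ ^+ i) (_^-1) (_^-1) (qpoch _ _ _) (qpoch _ _ _) => *; ring.
Qed.

Lemma side_prod l m : (m <= k l)%N ->
  \prod_(0 <= j < k l) side q n w (node q m (z l) j) =
  qpoch (w * z l) q (k l) * qpoch (q ^- k l * (w / z l) * q ^+ n) q (k l)
  * (q ^- (n * m) * (qpoch (q ^+ n * w * z l) q m / qpoch (w * z l) q m *
     (qpoch (q * z l / w) q m / qpoch (q ^ (1 - n%:Z) * z l / w) q m))).
Proof.
move=> mk.
have -> : qpoch (q ^- k l * (w / z l) * q ^+ n) q (k l) =
   \prod_(0 <= j < k l) (1 - q ^+ n * (w / z l) / (q * q ^+ j)).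
  by rewrite prod_rev_qpoch; congr (qpoch _ _ _); ring.
have d1 j : 1 - w * z l * q ^+ j != 0.
  by rewrite [_ * q ^+ j]mulrC off_lattice_1sub.
have d2 j : q * q ^+ j * z l - q ^+ n * w != 0.
  rewrite (_ : _ - _ = - (q ^+ n * (w / z l) - q ^+ j.+1) * z l).
    by rewrite mulf_neq0 // oppr_eq0 off_lattice_sub.
  by rewrite [q ^+ j.+1]exprS; field; rewrite z_neq0.
have e0 : q ^ (1 - n%:Z) = q / q ^+ n by rewrite expfzDr // expr1z -exprnN.
(* The ratio of [side] at the reflection of q^j z_l to [side] at q^j z_l itself; rewriting it in
   positive powers of z_l produces q^(-n). *)
pose c j := q ^- n * ((1 - q ^+ n * w * z l * q ^+ j) / (1 - w * z l * q ^+ j) *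
   ((1 - q * z l / w * q ^+ j) / (1 - q / q ^+ n * z l / w * q ^+ j))).
have -> : q ^- (n * m) * (qpoch (q ^+ n * w * z l) q m / qpoch (w * z l) q m *
     (qpoch (q * z l / w) q m / qpoch (q ^ (1 - n%:Z) * z l / w) q m)) =
   \prod_(0 <= j < m) c j.
  rewrite e0; elim: m {mk} => [|m IH].
    by rewrite muln0 !qpoch0 big_geq // expr0 !(divr1, mulr1, invr1).
  rewrite big_nat_recr //= -IH mulnS exprD !qpochS /c !invfM.
  move: (qpoch _ _ m) (qpoch _ _ m)^-1 (qpoch _ _ m) (qpoch _ _ m)^-1 => A B C D.
  move: (q ^- n) (q ^- _) (1 - _) (1 - _)^-1 (1 - _) (1 - _)^-1 => *; ring.
have -> : \prod_(0 <= j < m) c j = \prod_(0 <= j < k l) (if (j < m)%N then c j else 1).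
  rewrite !big_mkord (big_ord_widen (k l) c mk) big_mkcond; exact: eq_bigr.
rewrite /qpoch -2!big_split; apply: eq_big_nat => j _ /=.
rewrite /side /node; case: ifP => _; last first.
  rewrite mulr1; congr ((1 - _) * (1 - _)); first by ring.
  by field; rewrite ?q_neq0 ?qX_neq0 ?z_neq0.
have := d1 j; have := d2 j; rewrite /c; move: (qX_neq0 q_neq0 j) (qX_neq0 q_neq0 n) (z_neq0 l).
move: (q ^+ j) (q ^+ n) (z l) => x y u h1 h2 h3 h4 h5.
have h6 : y * w - q * u * x != 0 by rewrite -opprB oppr_eq0 [q * u * x]mulrAC.
by field; rewrite ?h1 ?h2 ?h3 ?h5 ?h6 ?w_neq0 ?q_neq0 ?oner_neq0.
Qed.

Lemma prod_pairs_le (g : 'I_s -> 'I_s -> F) :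
  \prod_(a < s) \prod_(b < s | (a <= b)%N) g a b =
  (\prod_(a < s) g a a) * \prod_(a < s) \prod_(b < s | (a < b)%N) g a b.
Proof.
rewrite -big_split; apply: eq_bigr => a _; rewrite (bigD1 a) //=; congr (_ * _).
by apply: eq_bigl => b; rewrite ltn_neqAle andbC eq_sym.
Qed.

Lemma prod_pairs_all (g : 'I_s -> 'I_s -> F) :
  \prod_(a < s) \prod_(b < s) g a b =
  (\prod_(a < s) g a a) *
  \prod_(a < s) \prod_(b < s | (a < b)%N) (g a b * g b a).
Proof.
transitivity (\prod_(a < s) (\prod_(b < s | (a <= b)%N) g a b
   * \prod_(b < s | (b < a)%N) g a b)).
  apply: eq_bigr => a _; rewrite (bigID (fun b : 'I_s => (a <= b)%N)) /=; congr (_ * _).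
  by apply: eq_bigl => b; rewrite ltnNge.
rewrite big_split /= prod_pairs_le -mulrA; congr (_ * _).
rewrite [X in _ * X](exchange_big_dep xpredT) //= -big_split /=.
by apply: eq_bigr => a _; rewrite -big_split.
Qed.

(** Single blocks contribute the exponents k_l m_l of q, pairs of blocks m_l k_l' + m_l' k_l;
    together they give |k| |m|. The sign comes from the single blocks alone. *)
Lemma pair_prod_bvar (m : 'I_s -> nat) : (forall l, (m l <= k l)%N) ->
  pair_prod (@blt s k) (fun x y => hl_factor q (flip q bvar (initial k m) x *
     flip q bvar (initial k m) y)) (blocks k) =
  (-1) ^+ weight m * q ^+ (weight k * weight m) *
  ((\prod_(a < s) \prod_(b < s | (a < b)%N)
       (qpoch (q ^+ (k b + 1) * z a * z b) q (k a)
        / qpoch (q * z a * z b) q (k a)))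
  * (\prod_(a < s)
       (qpoch (q * z a ^+ 2) (q ^+ 2) (k a) / qpoch (q * z a ^+ 2) q (k a)))
  * coef_c q z k m).
Proof.
move=> mk.
pose H l i l' j := hl_factor q (node q (m l) (z l) i * node q (m l') (z l') j).
rewrite (@eq_pair_prod _ _ _ _ (fun x y : bidx => H x.1 x.2 y.1 y.2)); last first.
  by move=> x y _ _; rewrite !flip_bvar.
rewrite pair_prod_blocks.
rewrite (eq_bigr (fun l => (-1) ^+ m l * q ^+ (k l * m l) *
  diag_target q (z l * z l) (k l) (m l))); last first.
  by move=> l _; apply: block_diag.
rewrite [X in _ * X](eq_bigr (fun l : 'I_s => \prod_(l' < s | (l < l')%N)
  (q ^+ (m l * k l' + m l' * k l) *
   pair_target q (z l * z l') (z l / z l') (k l) (k l') (m l) (m l')))); last first.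
  move=> l _; apply: eq_bigr => l' ll; apply: block_pair => //.
  by apply: off_z_z; rewrite -val_eqE neq_ltn ll.
have -> : (-1) ^+ weight m * q ^+ (weight k * weight m) =
  (\prod_(l < s) ((-1) ^+ m l * q ^+ (k l * m l))) *
  \prod_(l < s) \prod_(l' < s | (l < l')%N) q ^+ (m l * k l' + m l' * k l).
  rewrite big_split /= -mulrA; congr (_ * _); first by rewrite -expr_sum.
  rewrite /weight big_distrlr /= expr_sum.
  rewrite (eq_bigr (fun a => \prod_(b < s) q ^+ (k a * m b))); last first.
    by move=> a _; rewrite expr_sum.
  rewrite prod_pairs_all; congr (_ * _); apply: eq_bigr => a _; apply: eq_bigr => b _.
  by rewrite -exprD; congr (_ ^+ _); lia.
rewrite [X in _ * X = _](eq_bigr (fun l : 'I_s =>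
  \prod_(l' < s | (l < l')%N) q ^+ (m l * k l' + m l' * k l)
  * \prod_(l' < s | (l < l')%N)
      pair_target q (z l * z l') (z l / z l') (k l) (k l') (m l) (m l'))); last first.
  by move=> l _; rewrite big_split.
rewrite [X in X * _ = _]big_split [X in _ * X = _]big_split /= [LHS]mulrACA.
congr (_ * _); rewrite /coef_c prod_pairs_le prod_pairs_all.
have -> : \prod_(l < s) diag_target q (z l * z l) (k l) (m l) =
   (\prod_(a < s) (qpoch (q * z a ^+ 2) (q ^+ 2) (k a) / qpoch (q * z a ^+ 2) q (k a)))
   * (\prod_(a < s) ((1 - q ^+ (m a + m a) * z a * z a) / (1 - z a * z a)))
   * (\prod_(a < s) (qpoch (q ^- k a * z a / z a) q (m a) / qpoch (q * z a / z a) q (m a)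
       * (qpoch (z a * z a) q (m a) / qpoch (q ^+ (1 + k a) * z a * z a) q (m a)))).
  rewrite -!big_split; apply: eq_bigr => a _ /=.
  by rewrite !mulfK // /diag_target -![q ^+ _ * z a * z a]mulrA -expr2 !mulrA.
have -> : \prod_(l < s) \prod_(l' < s | (l < l')%N)
     pair_target q (z l * z l') (z l / z l') (k l) (k l') (m l) (m l') =
  (\prod_(a < s) \prod_(b < s | (a < b)%N)
       (qpoch (q ^+ (k b + 1) * z a * z b) q (k a) / qpoch (q * z a * z b) q (k a)))
  * (\prod_(a < s) \prod_(b < s | (a < b)%N)
      ((q ^+ m a * z a - q ^+ m b * z b) / (z a - z b)))
  * (\prod_(a < s) \prod_(b < s | (a < b)%N)
      ((1 - q ^+ (m a + m b) * z a * z b) / (1 - z a * z b)))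
  * (\prod_(a < s) \prod_(b < s | (a < b)%N)
     ((qpoch (q ^- k b * z a / z b) q (m a) / qpoch (q * z a / z b) q (m a)
       * (qpoch (z a * z b) q (m a)
          / qpoch (q ^+ (1 + k b) * z a * z b) q (m a))) *
      (qpoch (q ^- k a * z b / z a) q (m b) / qpoch (q * z b / z a) q (m b)
       * (qpoch (z b * z a) q (m b)
          / qpoch (q ^+ (1 + k a) * z b * z a) q (m b))))).
  rewrite -!big_split; apply: eq_bigr => a _ /=.
  rewrite -!big_split; apply: eq_bigr => b ab /=.
  rewrite /pair_target -!mulrA !invf_div [z b * z a]mulrC.
  (* The Vandermonde factor in ratio form, multiplied through by z_b. *)
  have e : (q ^+ m a * (z a / z b) - q ^+ m b) / (z a / z b - 1) =
     (q ^+ m a * z a - q ^+ m b * z b) / (z a - z b).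
    have nab : a != b by rewrite -val_eqE neq_ltn ab.
    have h : z a - z b != 0.
      rewrite subr_eq0; apply: contra (off_z_z nab 0) => /eqP ->.
      by rewrite expr0z divff.
    by field; rewrite z_neq0 h.
  congr (_ * (_ * _)); rewrite [LHS]mulrA [RHS]mulrA e; congr (_ * (_ * (_ * (_ * (_ * _))))).
  by ring.
ring.
Qed.

Lemma prod_side (m : 'I_s -> nat) : (forall l, (m l <= k l)%N) ->
  \prod_(x in blocks k) side q n w (flip q bvar (initial k m) x) =
  side_denom * q ^- (n * weight m) *
  \prod_(l < s)
           (qpoch (q ^+ n * w * z l) q (m l) / qpoch (w * z l) q (m l)
            * (qpoch (q * z l / w) q (m l)
               / qpoch (q ^ (1 - n%:Z) * z l / w) q (m l))).
Proof.
move=> mk.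
rewrite (eq_bigr (fun x : bidx => side q n w (node q (m x.1) (z x.1) x.2))); last first.
  by move=> x _; rewrite flip_bvar.
rewrite (big_blocks k _ (fun l j => side q n w (node q (m l) (z l) j))).
rewrite (eq_bigr _ (fun l _ => side_prod (mk l))) !big_split /= -!mulrA.
rewrite /side_denom big_split /= -!mulrA; congr (_ * (_ * _)); congr (_ * _).
by rewrite /weight big_distrr /= expr_sum prodfV.
Qed.

Lemma reduction :
  qpoch (q * w ^+ 2) (q ^+ 2) n / qpoch (w ^+ 2) q n
  * (\prod_(l < s) (qpoch (q ^- k l * w / z l) q n / qpoch (w / z l) q n))
  * qhyp
      ([:: w ^+ 2 / q; q ^- n]
         ++ interleave (fun l => w / z l) (fun l => q ^+ k l * w * z l))
      ([:: q ^+ n * w ^+ 2]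
         ++ interleave (fun l => w * z l) (fun l => q ^- k l * w / z l))
      q (- q ^ (n%:Z - (weight k)%:Z + 1))
  =
  q ^- 'C(weight k, 2) * qpochN q (n%:Z - (weight k)%:Z)
  * (\prod_(a < s) \prod_(b < s | (a < b)%N)
       (qpoch (q ^+ (k b + 1) * z a * z b) q (k a)
        / qpoch (q * z a * z b) q (k a)))
  * (\prod_(a < s)
       (qpoch (q * z a ^+ 2) (q ^+ 2) (k a) / qpoch (q * z a ^+ 2) q (k a)))
  * \sum_(m : {dffun forall l : 'I_s, 'I_(k l).+1})
      ((-1) ^+ weight (fun l => m l)
       * coef_c q z k (fun l => m l)
       * q ^ (((weight k)%:Z - n%:Z) * (weight (fun l => m l))%:Z)
       * \prod_(l < s)
           (qpoch (q ^+ n * w * z l) q (m l) / qpoch (w * z l) q (m l)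
            * (qpoch (q * z l / w) q (m l)
               / qpoch (q ^ (1 - n%:Z) * z l / w) q (m l)))).
Proof.
have := wp_flip_sum q_neq0 q_expn q_expn1 (@blt_irr s k) (@blt_tot s k) n bvar_generic.
rewrite card_blocks flip_sum_blocks lhs_wp_sum => ->.
rewrite -!mulrA; congr (_ * (_ * _)).
rewrite mulr_suml !mulr_sumr; apply: eq_bigr => m _.
have mk l : (m l <= k l)%N by rewrite -ltnS.
rewrite /flip_term pair_prod_bvar // prod_side //.
(* The first power comes from the pairs of points, the second from the factors [side]. *)
have -> : q ^ (((weight k)%:Z - n%:Z) * (weight (fun l => m l))%:Z) =
   q ^+ (weight k * weight (fun l => m l)) * q ^- (n * weight (fun l => m l)).
  by rewrite mulrBl expfzDr // -!PoszM -exprnN.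
have := side_denom_neq0; move: side_denom (coef_c _ _ _ _) (\prod_(l < s) (_ * _)).
move: (\prod_(a < s) _) (\prod_(a < s) _) (q ^+ _) (q ^- _) ((-1) ^+ _) => A B C D E G H I h.
by field.
Qed.

End Reduction.

(** * Indeterminates *)

Section Indeterminates.
Variables (K : fieldType) (N : nat).
Implicit Types (m : 'X_{1..N}).

(** The quantities to be kept off the powers of q are quotients of monomials, so these conditions
    become comparisons of exponents. *)
Definition monom m : ratfun K N := tofrac ('X_[m] : {mpoly K[N]}).

Lemma monom_inj : injective monom.
Proof.
move=> m1 m2 /eqP; rewrite tofrac_eq => /eqP /(congr1 (mcoeff m2)) /eqP.
by rewrite !mcoeffX eqxx; case: (m1 =P m2) => // _; rewrite eq_sym oner_eq0.
Qed.

Lemma indetE i : indet K i = monom U_(i)%MM.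
Proof. by []. Qed.

Lemma monomD m1 m2 : monom (m1 + m2)%MM = monom m1 * monom m2.
Proof. by rewrite /monom mpolyXD tofracM. Qed.

Lemma monomX m i : monom m ^+ i = monom (m *+ i)%MM.
Proof. by rewrite /monom -tofracXn mpolyXn. Qed.

Lemma monom0 : monom 0%MM = 1.
Proof. by rewrite /monom mpolyX0 tofrac1. Qed.

Lemma monom_neq0 m : monom m != 0.
Proof.
by rewrite tofrac_eq0; apply/eqP => /(congr1 (mcoeff m)) /eqP;
  rewrite mcoeffX eqxx mcoeff0 oner_eq0.
Qed.

(** Multiplication by a power of X_i leaves the exponent of X_j unchanged. A negative power is first
    moved to the other side, to stay among monomials. *)
Lemma off_lattice_monom (i j : 'I_N) m1 m2 (c : ratfun K N) :
  i != j -> c * monom m2 = monom m1 -> m1 j != m2 j ->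
  off_lattice (indet K i) c.
Proof.
move=> ij cm h [e|e]; rewrite indetE; apply: contra h => /eqP h; apply/eqP.
  have {}h : monom m1 = monom ((U_(i) *+ e) + m2)%MM by rewrite monomD -monomX -cm h.
  move/monom_inj: h => ->.
  by rewrite mnmDE mulmnE mnm1E (negbTE ij) mul0n.
have {}h : monom ((U_(i) *+ e.+1) + m1)%MM = monom m2.
  rewrite monomD -monomX -cm h.
  by rewrite -[_ ^ _]/(_ ^- e.+1) mulVKf // expf_neq0 ?monom_neq0.
by rewrite -(monom_inj h) mnmDE mulmnE mnm1E (negbTE ij) mul0n.
Qed.

Lemma indet_expn i e : (0 < e)%N -> indet K i ^+ e != 1 :> ratfun K N.
Proof.
move=> e0; rewrite indetE monomX -monom0 (inj_eq monom_inj).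
apply/eqP => /(congr1 (fun m : 'X_{1..N} => m i)); rewrite mulmnE mnm1E mnm0E eqxx; lia.
Qed.

Lemma indet_expn1 i e : [pchar K] =i pred0 -> indet K i ^+ e + 1 != 0 :> ratfun K N.
Proof.
move=> cK; rewrite indetE monomX -monom0 -tofracD tofrac_eq0.
apply/eqP => /(congr1 (mcoeff 0%MM)) /eqP; rewrite mcoeffD !mcoeffX mcoeff0 eqxx.
(* The constant coefficient is 1 for a positive exponent and 2 for exponent zero, where
   characteristic zero enters. *)
case: (_ =P 0%MM) => _; last by rewrite add0r oner_eq0.
by have := cK 2%N; rewrite !inE /= => ->.
Qed.

End Indeterminates.

Theorem theorem11 (K : fieldType) (charK0 : [pchar K] =i pred0)
    (n s : nat) (k : 'I_s -> nat)
    (n_ge1 : (1 <= n)%N) (k_gt0 : forall l : 'I_s, (0 < k l)%N) :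
  let q : ratfun K (2 + s) := indet K (lshift s (0 : 'I_2)) in
  let w : ratfun K (2 + s) := indet K (lshift s (1 : 'I_2)) in
  let z : 'I_s -> ratfun K (2 + s) := fun l => indet K (rshift 2 l) in
  qpoch (q * w ^+ 2) (q ^+ 2) n / qpoch (w ^+ 2) q n
  * (\prod_(l < s) (qpoch (q ^- k l * w / z l) q n / qpoch (w / z l) q n))
  * qhyp
      ([:: w ^+ 2 / q; q ^- n]
         ++ interleave (fun l => w / z l) (fun l => q ^+ k l * w * z l))
      ([:: q ^+ n * w ^+ 2]
         ++ interleave (fun l => w * z l) (fun l => q ^- k l * w / z l))
      q (- q ^ (n%:Z - (weight k)%:Z + 1))
  =
  q ^- 'C(weight k, 2) * qpochN q (n%:Z - (weight k)%:Z)
  * (\prod_(a < s) \prod_(b < s | (a < b)%N)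
       (qpoch (q ^+ (k b + 1) * z a * z b) q (k a)
        / qpoch (q * z a * z b) q (k a)))
  * (\prod_(a < s)
       (qpoch (q * z a ^+ 2) (q ^+ 2) (k a) / qpoch (q * z a ^+ 2) q (k a)))
  * \sum_(m : {dffun forall l : 'I_s, 'I_(k l).+1})
      ((-1) ^+ weight (fun l => m l)
       * coef_c q z k (fun l => m l)
       * q ^ (((weight k)%:Z - n%:Z) * (weight (fun l => m l))%:Z)
       * \prod_(l < s)
           (qpoch (q ^+ n * w * z l) q (m l) / qpoch (w * z l) q (m l)
            * (qpoch (q * z l / w) q (m l)
               / qpoch (q ^ (1 - n%:Z) * z l / w) q (m l)))).
Proof.
move=> q w z.
have qw : lshift s (0 : 'I_2) != lshift s (1 : 'I_2) by rewrite -val_eqE.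
have qz l : lshift s (0 : 'I_2) != rshift 2 l by rewrite -val_eqE.
have wz l : lshift s (1 : 'I_2) != rshift 2 l by rewrite -val_eqE.
(* Each off-lattice condition is detected by the exponent of one variable other than q: w if it
   occurs, and z_l otherwise. *)
apply: reduction.
- exact: monom_neq0.
- by move=> i; apply: indet_expn.
- by move=> i; apply: indet_expn1.
- by move=> l; apply: monom_neq0.
- exact: monom_neq0.
- move=> l l'.
  apply: (@off_lattice_monom K _ _ _ (U_(rshift 2 l) + U_(rshift 2 l'))%MM 0%MM _ (qz l)).
    by rewrite monom0 mulr1 monomD.
  by rewrite mnmDE !mnm1E mnm0E eqxx.
- move=> l l' ll.
  apply: (@off_lattice_monom K _ _ _ U_(rshift 2 l)%MM U_(rshift 2 l')%MM _ (qz l)).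
    by rewrite divfK // monom_neq0.
  by rewrite !mnm1E eqxx (inj_eq (@rshift_inj _ _)) [l' == l]eq_sym (negbTE ll).
- apply: (@off_lattice_monom K _ _ _ (U_(lshift s 1) *+ 2)%MM 0%MM _ qw).
    by rewrite monom0 mulr1 -monomX.
  by rewrite mulmnE mnm1E mnm0E eqxx.
- move=> l.
  apply: (@off_lattice_monom K _ _ _ (U_(lshift s 1) + U_(rshift 2 l))%MM 0%MM _ qw).
    by rewrite monom0 mulr1 monomD.
  by rewrite mnmDE !mnm1E mnm0E eqxx.
move=> l.
apply: (@off_lattice_monom K _ _ _ U_(lshift s 1)%MM U_(rshift 2 l)%MM _ qw).
  by rewrite divfK // monom_neq0.
by rewrite !mnm1E eqxx [rshift 2 l == _]eq_sym (negbTE (wz l)).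
Qed.
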